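(* Let $(\mathcal{X},\mathcal{Y})$ be a balanced pair in a triangulated category $\mathcal{C}$ with suspension functor $\Sigma$. Then $\xi:=\xi_{\mathcal{X}}=\xi^{\mathcal{Y}}$ is a proper class of triangles in $\mathcal{C}$. Let $\mathbb{E}(C,A)=\mathcal{C}(C,\Sigma A)$, and let $\mathfrak{s}$ be the realization sending $\delta\in\mathbb{E}(C,A)$ to the equivalence class $[A\xrightarrow{x}B\xrightarrow{y}C]$, where $A\xrightarrow{x}B\xrightarrow{y}C\xrightarrow{\delta}\Sigma A$ is a distinguished triangle. Set $$\mathbb{E}_\xi(C,A)=\{\delta\in\mathbb{E}(C,A)\mid \text{the triangle } A\xrightarrow{x}B\xrightarrow{y}C\xrightarrow{\delta}\Sigma A \text{ realizing } \delta \text{ belongs to } \xi\}$$ for all $A,C\in\mathcal{C}$, and $\mathfrak{s}_\xi:=\mathfrak{s}|_{\mathbb{E}_\xi}$. Then $(\mathcal{C},\mathbb{E}_\xi,\mathfrak{s}_\xi)$ is an extriangulated category. Moreover: (1) $(\mathcal{C},\mathbb{E}_\xi,\mathfrak{s}_\xi)$ is a triangulated category if and only if $\mathcal{X}=\mathcal{Y}=0$; and (2) $(\mathcal{C},\mathbb{E}_\xi,\mathfrak{s}_\xi)$ is an exact category if and only if $\mathcal{X}=\mathcal{Y}=\mathcal{C}$.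
   Context: $\mathcal{C}=(\mathcal{C},\Sigma,\Delta)$ is a triangulated category with suspension functor $\Sigma$ and class of (distinguished) triangles $\Delta$; ''triangle'' means element of $\Delta$. A triangle $A\xrightarrow{f}B\xrightarrow{g}C\xrightarrow{h}\Sigma A$ is split if $h=0$; $\Delta_0\subseteq\Delta$ is the class of split triangles. **Proper classes.** Given a triangle $A\xrightarrow{f}B\xrightarrow{g}C\xrightarrow{h}\Sigma A$ and a morphism $\varepsilon:E\to C$, a base change diagram is a commutative diagram of triangles consisting of rows $A\xrightarrow{f'}G\xrightarrow{g'}E\xrightarrow{h'}\Sigma A$ and $A\xrightarrow{f}B\xrightarrow{g}C\xrightarrow{h}\Sigma A$ and columns $M\xrightarrow{\alpha}G\xrightarrow{\beta}B\xrightarrow{\gamma}\Sigma M$ and $M\xrightarrow{\delta}E\xrightarrow{\varepsilon}C\xrightarrow{\zeta}\Sigma M$, with $\beta f'=f$, $g\beta=\varepsilon g'$, $h'=h\varepsilon$, $g'\alpha=\delta$, $\gamma=\zeta g$. A class $\xi$ of triangles is closed under base change if in every such diagram $(f,g,h)\in\xi$ implies $(f',g',h')\in\xi$. Dually, $\xi$ is closed under cobase change if for $(f,g,h)\in\xi$ and any $\alpha:A\to D$, the triangle $D\to F\to C\xrightarrow{(\Sigma\alpha) h}\Sigma D$ obtained by cobase change lies in $\xi$. $\xi$ is closed under suspensions if $(f,g,h)\in\xi$ implies that the triangle $\Sigma^iA\to\Sigma^iB\to\Sigma^iC\to\Sigma^{i+1}A$ with morphisms $(-1)^i\Sigma^if,(-1)^i\Sigma^ig,(-1)^i\Sigma^ih$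 is in $\xi$ for all $i\in\mathbb{Z}$. $\xi$ is saturated if in every base change diagram, $(\delta,\varepsilon,\zeta)\in\xi$ and $(f',g',h')\in\xi$ imply $(f,g,h)\in\xi$. A proper class of triangles is a full subcategory $\xi\subseteq\Delta$ that is closed under isomorphisms and finite coproducts, satisfies $\Delta_0\subseteq\xi\subseteq\Delta$, is closed under suspensions, is saturated, and is closed under base change and cobase change. **Projectives and injectives.** For a proper class $\xi$, an object $P$ is $\xi$-projective if for every triangle $A\to B\to C\to\Sigma A$ in $\xi$ the sequence $0\to\mathcal{C}(P,A)\to\mathcal{C}(P,B)\to\mathcal{C}(P,C)\to0$ is exact; $I$ is $\xi$-injective if for every such triangle $0\to\mathcal{C}(C,I)\to\mathcal{C}(B,I)\to\mathcal{C}(A,I)\to0$ is exact. $\mathcal{P}(\xi)$ and $\mathcal{I}(\xi)$ are the full subcategories of $\xi$-projective and $\xi$-injective objects. $\mathcal{C}$ has enough $\xi$-projectives if for each object $A$ there is a triangle $K\to P\to A\to\Sigma K$ in $\xi$ with $P\in\mathcal{P}(\xi)$, and enough $\xi$-injectives if for each $A$ there is a triangle $A\to I\to K\to\Sigma A$ in $\xi$ with $I\in\mathcal{I}(\xi)$. **The classes $\xi_{\mathcal{X}}$ and $\xi^{\mathcal{Y}}$.** A subcategory $\mathcal{X}$ is $\Sigma$-stable if $\Sigma(\mathcal{X})=\mathcal{X}$. For a $\Sigma$-stable full additive subcategory $\mathcal{X}$, $\xi_{\mathcal{X}}$ is the class of triangles $A\xrightarrow{f}B\xrightarrow{g}C\xrightarrow{h}\Sigma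 A$ that are $\mathcal{C}(\mathcal{X},-)$-exact, i.e. for every $X\in\mathcal{X}$, $\mathcal{C}(X,f)$ is a monomorphism and $\mathcal{C}(X,g)$ is an epimorphism (by $\Sigma$-stability, either condition for all $X\in\mathcal{X}$ implies the other). For a $\Sigma$-stable full additive subcategory $\mathcal{Y}$, $\xi^{\mathcal{Y}}$ is the class of triangles that are $\mathcal{C}(-,\mathcal{Y})$-exact, i.e. for every $Y\in\mathcal{Y}$, $\mathcal{C}(g,Y)$ is a monomorphism and $\mathcal{C}(f,Y)$ is an epimorphism (again either implies the other). **Resolutions.** For a proper class $\xi$, a $\xi$-exact complex is a diagram $\cdots\to X_1\xrightarrow{d_1}X_0\xrightarrow{d_0}X_{-1}\to\cdots$ for which there are triangles $K_{n+1}\xrightarrow{g_n}X_n\xrightarrow{f_n}K_n\xrightarrow{h_n}\Sigma K_{n+1}$ in $\xi$ with $d_n=g_{n-1}f_n$. It is called $\mathcal{C}(-,\mathcal{Y})$-exact (resp. $\mathcal{C}(\mathcal{X},-)$-exact) if these triangles can be chosen to be moreover $\mathcal{C}(-,\mathcal{Y})$-exact (resp. $\mathcal{C}(\mathcal{X},-)$-exact). An $\mathcal{X}$-resolution of $M$ is a $\xi_{\mathcal{X}}$-exact complex $\cdots\to X_1\to X_0\to M$ with all $X_i\in\mathcal{X}$ (so the triangles are indexed by $n\ge0$ with $K_0=M$). A $\mathcal{Y}$-coresolution of $M$ is a $\xi^{\mathcal{Y}}$-exact complex $M\to Y_0\to Y_{-1}\to\cdots$ with all $Y_i\in\mathcal{Y}$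 (the dual notion). $\mathcal{X}$ is contravariantly finite if every $C\in\mathcal{C}$ admits a morphism $X\to C$ with $X\in\mathcal{X}$ such that $\mathcal{C}(X',X)\to\mathcal{C}(X',C)$ is surjective for all $X'\in\mathcal{X}$; $\mathcal{Y}$ is covariantly finite if every $C$ admits $C\to Y$ with $Y\in\mathcal{Y}$ such that $\mathcal{C}(Y,Y')\to\mathcal{C}(C,Y')$ is surjective for all $Y'\in\mathcal{Y}$. **Balanced pairs.** A pair $(\mathcal{X},\mathcal{Y})$ of $\Sigma$-stable full additive subcategories of $\mathcal{C}$, both closed under direct summands, is a balanced pair if it satisfies the following equivalent conditions: (i) $\xi_{\mathcal{X}}=\xi^{\mathcal{Y}}$, $\mathcal{X}=\mathcal{P}(\xi_{\mathcal{X}})$, $\mathcal{Y}=\mathcal{I}(\xi^{\mathcal{Y}})$, and $\mathcal{C}$ has enough $\xi_{\mathcal{X}}$-projectives and enough $\xi^{\mathcal{Y}}$-injectives; (ii) $\mathcal{X}$ is contravariantly finite and $\mathcal{Y}$ is covariantly finite in $\mathcal{C}$, every object $M$ has an $\mathcal{X}$-resolution that is $\mathcal{C}(-,\mathcal{Y})$-exact, and every object $N$ has a $\mathcal{Y}$-coresolution that is $\mathcal{C}(\mathcal{X},-)$-exact. **Extriangulated categories (Nakaoka–Palu).** Let $\mathcal{C}$ be an additive category and $\mathbb{E}:\mathcal{C}^{\rm op}\times\mathcal{C}\to\mathrm{Ab}$ an additive bifunctor. For $\delta\in\mathbb{E}(C,A)$, $a:A\to A'$, $c:C'\to C$ write $a_*\delta=\mathbb{E}(C,a)(\delta)$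 and $c^*\delta=\mathbb{E}(c,A)(\delta)$. A morphism from $\delta\in\mathbb{E}(C,A)$ to $\delta'\in\mathbb{E}(C',A')$ is a pair $(a:A\to A',c:C\to C')$ with $a_*\delta=c^*\delta'$. Two sequences $A\xrightarrow{x}B\xrightarrow{y}C$ and $A\xrightarrow{x'}B'\xrightarrow{y'}C$ are equivalent if there is an isomorphism $b:B\to B'$ with $bx=x'$ and $y'b=y$; $[\,\cdot\,]$ denotes equivalence classes. A realization $\mathfrak{s}$ assigns to each $\delta\in\mathbb{E}(C,A)$ an equivalence class $\mathfrak{s}(\delta)=[A\xrightarrow{x}B\xrightarrow{y}C]$ such that for any morphism $(a,c):\delta\to\delta'$, with $\mathfrak{s}(\delta')=[A'\xrightarrow{x'}B'\xrightarrow{y'}C']$, there is $b:B\to B'$ with $bx=x'a$ and $y'b=cy$. It is additive if $\mathfrak{s}(0)=[A\to A\oplus C\to C]$ and $\mathfrak{s}(\delta\oplus\delta')=\mathfrak{s}(\delta)\oplus\mathfrak{s}(\delta')$. The triplet $(\mathcal{C},\mathbb{E},\mathfrak{s})$ is extriangulated if $\mathbb{E}$ is an additive bifunctor, $\mathfrak{s}$ is an additive realization, and: (ET3) if $\mathfrak{s}(\delta)=[A\xrightarrow{x}B\xrightarrow{y}C]$, $\mathfrak{s}(\delta')=[A'\xrightarrow{x'}B'\xrightarrow{y'}C']$ and $bx=x'a$, then there is $c:C\to C'$ with $cy=y'b$ and $a_*\delta=c^*\delta'$; (ET3)$^{\rm op}$ in the same situation, if $cy=y'b$, there is $a:A\to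 A'$ with $bx=x'a$ and $a_*\delta=c^*\delta'$; (ET4) if $\delta\in\mathbb{E}(D,A)$, $\delta'\in\mathbb{E}(F,B)$ are realized by $A\xrightarrow{f}B\xrightarrow{f'}D$ and $B\xrightarrow{g}C\xrightarrow{g'}F$, then there are an object $E$, morphisms $h':C\to E$, $d:D\to E$, $e:E\to F$ with $h'g=df'$, $eh'=g'$, and $\delta''\in\mathbb{E}(E,A)$ realized by $A\xrightarrow{gf}C\xrightarrow{h'}E$, such that $D\xrightarrow{d}E\xrightarrow{e}F$ realizes $f'_*\delta'$, $d^*\delta''=\delta$, and $f_*\delta''=e^*\delta'$; (ET4)$^{\rm op}$ if $\delta\in\mathbb{E}(B,D)$, $\delta'\in\mathbb{E}(C,F)$ are realized by $D\xrightarrow{f'}A\xrightarrow{f}B$ and $F\xrightarrow{g'}B\xrightarrow{g}C$, then there are an object $E$, morphisms $h':E\to A$, $d:D\to E$, $e:E\to F$ with $h'd=f'$, $fh'=g'e$, and $\delta''\in\mathbb{E}(C,E)$ realized by $E\xrightarrow{h'}A\xrightarrow{gf}C$, such that $D\xrightarrow{d}E\xrightarrow{e}F$ realizes $g'^*\delta$, $\delta'=e_*\delta''$, and $d_*\delta=g^*\delta''$. A sequence $A\xrightarrow{x}B\xrightarrow{y}C$ realizing some $\delta\in\mathbb{E}(C,A)$ is a conflation; $x$ is then an inflation and $y$ a deflation. An extriangulated category $(\mathcal{C},\mathbb{E},\mathfrak{s})$ ''is a triangulated category'' if its structure comes from a triangulated structure on $\mathcal{C}$: there are an autoequivalence $S$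 of $\mathcal{C}$, a triangulated structure on $\mathcal{C}$ with suspension $S$, and a natural isomorphism $\mathbb{E}\cong\mathcal{C}(-,S-)$ under which $\mathfrak{s}(\delta)=[A\xrightarrow{x}B\xrightarrow{y}C]$ exactly when $A\xrightarrow{x}B\xrightarrow{y}C\xrightarrow{\delta}SA$ is distinguished. It ''is an exact category'' if its structure comes from a Quillen exact structure, i.e. its conflations form an exact structure on $\mathcal{C}$ with $\mathbb{E}$ the corresponding $\mathrm{Ext}^1$ and $\mathfrak{s}$ the tautological realization; equivalently, every inflation is a monomorphism and every deflation is an epimorphism. *)

(* Defs.v *)
From HB Require Import structures.
From mathcomp Require Import all_boot all_algebra.
From mathcomp Require Import boolp.

Set Implicit Arguments.
Unset Strict Implicit.
Unset Printing Implicit Defensive.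

Import GRing.Theory.
Local Open Scope ring_scope.

Record preadditive := Preadditive {
  ob :> Type;
  hom : ob -> ob -> zmodType;
  idm : forall A, hom A A;
  compose : forall A B C, hom B C -> hom A B -> hom A C;
  composeA : forall A B C D (h : hom C D) (g : hom B C) (f : hom A B),
    compose h (compose g f) = compose (compose h g) f;
  compose1m : forall A B (f : hom A B), compose (idm B) f = f;
  composem1 : forall A B (f : hom A B), compose f (idm A) = f;
  composeDl : forall A B C (g g' : hom B C) (f : hom A B),
    compose (g + g') f = compose g f + compose g' f;
  composeDr : forall A B C (g : hom B C) (f f' : hom A B),
    compose g (f + f') = compose g f + compose g f' }.

Arguments hom {_} _ _.
Arguments idm {_} _.
Arguments compose {_ _ _ _} _ _.

Notation "A ~> B" := (hom A B) (at level 60, no associativity).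
Notation "g ∘ f" := (compose g f) (at level 40, left associativity).

Section Preadditive.
Variable C : preadditive.

Lemma compose0l (A B D : C) (f : A ~> B) : (0 : B ~> D) ∘ f = 0.
Proof. by apply: (addrI (0 ∘ f)); rewrite -composeDl !addr0. Qed.

Lemma compose0r (A B D : C) (g : B ~> D) : g ∘ (0 : A ~> B) = 0.
Proof. by apply: (addrI (g ∘ 0)); rewrite -composeDr !addr0. Qed.

Definition is_iso (A B : C) (f : A ~> B) : Prop :=
  exists g : B ~> A, g ∘ f = idm A /\ f ∘ g = idm B.

Definition isomorphic (A B : C) : Prop := exists f : A ~> B, is_iso f.

Definition is_zero (Z : C) : Prop :=
  forall A : C, (forall f : Z ~> A, f = 0) /\ (forall f : A ~> Z, f = 0).

Record biproduct (A B : C) := Biproduct {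
  bip :> C;
  in1 : A ~> bip;
  in2 : B ~> bip;
  pr1 : bip ~> A;
  pr2 : bip ~> B;
  pr1_in1 : pr1 ∘ in1 = idm A;
  pr2_in2 : pr2 ∘ in2 = idm B;
  pr1_in2 : pr1 ∘ in2 = 0;
  pr2_in1 : pr2 ∘ in1 = 0;
  in_pr : in1 ∘ pr1 + in2 ∘ pr2 = idm bip }.

Definition dsum (A B A' B' : C) (S : biproduct A B) (S' : biproduct A' B')
    (f : A ~> A') (g : B ~> B') : S ~> S' :=
  in1 S' ∘ f ∘ pr1 S + in2 S' ∘ g ∘ pr2 S.

End Preadditive.

Record additive_category := AdditiveCategory {
  addcat :> preadditive;
  has_zero : exists Z : addcat, is_zero Z;
  has_biproducts : forall A B : addcat, inhabited (biproduct A B) }.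

Record endofunctor (C : preadditive) := Endofunctor {
  fob :> C -> C;
  fmap : forall A B : C, A ~> B -> fob A ~> fob B;
  fmap1 : forall A, fmap (idm A) = idm (fob A);
  fmapM : forall A B D (g : B ~> D) (f : A ~> B),
    fmap (g ∘ f) = fmap g ∘ fmap f;
  fmapD : forall A B (f g : A ~> B), fmap (f + g) = fmap f + fmap g }.

Arguments fmap {C} _ {A B} _.

Lemma fmap0 (C : preadditive) (F : endofunctor C) (A B : C) :
  fmap F (0 : A ~> B) = 0.
Proof. by apply: (addrI (fmap F 0)); rewrite -fmapD !addr0. Qed.

Program Definition fmap_biproduct (C : preadditive) (F : endofunctor C)
    (A B : C) (S : biproduct A B) : biproduct (F A) (F B) :=
  @Biproduct C (F A) (F B) (F S) (fmap F (in1 S)) (fmap F (in2 S))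
    (fmap F (pr1 S)) (fmap F (pr2 S)) _ _ _ _ _.
Next Obligation. by rewrite -fmapM pr1_in1 fmap1. Qed.
Next Obligation. by rewrite -fmapM pr2_in2 fmap1. Qed.
Next Obligation. by rewrite -fmapM pr1_in2 fmap0. Qed.
Next Obligation. by rewrite -fmapM pr2_in1 fmap0. Qed.
Next Obligation.
by rewrite -!fmapM -fmapD in_pr fmap1.
Qed.

(* An autoequivalence is given with a quasi-inverse [loops] as an adjoint
   equivalence (every equivalence can be completed to one); the triangle
   identity makes the comparison isomorphism between [loops (susp A)] and
   [susp (loops A)] used for negative suspensions the canonical one. *)
Record autoequivalence (C : preadditive) := Autoequivalence {
  susp :> endofunctor C;
  loops : endofunctor C;
  eta : forall A, A ~> loops (susp A);
  etaV : forall A, loops (susp A) ~> A;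
  eps : forall A, susp (loops A) ~> A;
  epsV : forall A, A ~> susp (loops A);
  eta_nat : forall A B (f : A ~> B),
    eta B ∘ f = fmap loops (fmap susp f) ∘ eta A;
  eps_nat : forall A B (f : A ~> B),
    f ∘ eps A = eps B ∘ fmap susp (fmap loops f);
  etaK : forall A, etaV A ∘ eta A = idm A;
  etaVK : forall A, eta A ∘ etaV A = idm _;
  epsK : forall A, epsV A ∘ eps A = idm _;
  epsVK : forall A, eps A ∘ epsV A = idm A;
  triangle_id : forall A, eps (susp A) ∘ fmap susp (eta A) = idm (susp A) }.

Section Triangles.
Variables (C : preadditive) (S : autoequivalence C).

Record triangle := Triangle {
  tA : C; tB : C; tC : C;
  tf : tA ~> tB;
  tg : tB ~> tC;
  th : tC ~> S tA }.

Definition triangle_class := triangle -> Prop.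

Definition triangle_iso (T T' : triangle) : Prop :=
  exists (a : tA T ~> tA T') (b : tB T ~> tB T') (c : tC T ~> tC T'),
    [/\ is_iso a, is_iso b & is_iso c] /\
    [/\ b ∘ tf T = tf T' ∘ a, c ∘ tg T = tg T' ∘ b
      & fmap S a ∘ th T = th T' ∘ c].

Definition triangle_sum (T T' : triangle) (SA : biproduct (tA T) (tA T'))
    (SB : biproduct (tB T) (tB T')) (SC : biproduct (tC T) (tC T')) : triangle :=
  @Triangle SA SB SC (dsum SA SB (tf T) (tf T')) (dsum SB SC (tg T) (tg T'))
    (dsum SC (fmap_biproduct S SA) (th T) (th T')).

Definition shift (T : triangle) : triangle :=
  Triangle (- fmap S (tf T)) (- fmap S (tg T)) (- fmap S (th T)).

Definition unshift (T : triangle) : triangle :=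
  Triangle (- fmap (loops S) (tf T)) (- fmap (loops S) (tg T))
    (- (epsV S _ ∘ etaV S _ ∘ fmap (loops S) (th T))).

(* The triangle ((-1)^i Sigma^i f, (-1)^i Sigma^i g, (-1)^i Sigma^i h); the
   signs accumulate along the iteration. *)
Definition suspension (i : int) (T : triangle) : triangle :=
  match i with
  | Posz n => iter n shift T
  | Negz n => iter n.+1 unshift T
  end.

End Triangles.

Arguments Triangle {C S tA tB tC} _ _ _.

Record triangulated (C : additive_category) (S : autoequivalence C)
    (Delta : triangle_class S) : Prop := Triangulated {
  tr_iso : forall T T', triangle_iso T T' -> Delta T -> Delta T';
  tr_id : forall A Z : C, is_zero Z ->
    Delta (Triangle (idm A) (0 : A ~> Z) (0 : Z ~> S A));
  tr_cone : forall (A B : C) (f : A ~> B),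
    exists (D : C) (g : B ~> D) (h : D ~> S A), Delta (Triangle f g h);
  tr_rotate : forall (A B D : C) (f : A ~> B) (g : B ~> D) (h : D ~> S A),
    Delta (Triangle f g h) <-> Delta (Triangle g h (- fmap S f));
  tr_morphism : forall T T', Delta T -> Delta T' ->
    forall (a : tA T ~> tA T') (b : tB T ~> tB T'), b ∘ tf T = tf T' ∘ a ->
    exists c : tC T ~> tC T',
      c ∘ tg T = tg T' ∘ b /\ fmap S a ∘ th T = th T' ∘ c;
  tr_octahedral : forall (A B D E F G : C)
      (f : A ~> B) (f' : B ~> D) (f'' : D ~> S A)
      (g : B ~> G) (g' : G ~> F) (g'' : F ~> S B)
      (h' : G ~> E) (h'' : E ~> S A),
    Delta (Triangle f f' f'') -> Delta (Triangle g g' g'') ->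
    Delta (Triangle (g ∘ f) h' h'') ->
    exists (d : D ~> E) (e : E ~> F),
      [/\ Delta (Triangle d e (fmap S f' ∘ g'')),
          d ∘ f' = h' ∘ g, e ∘ h' = g', h'' ∘ d = f''
        & g'' ∘ e = fmap S f ∘ h''] }.

Section ProperClass.
Variables (C : additive_category) (S : autoequivalence C).
Variable Delta : triangle_class S.

Definition split_triangle (T : triangle S) : Prop := Delta T /\ th T = 0.

Record base_change_diagram (A B D E G M : C)
    (f : A ~> B) (g : B ~> D) (h : D ~> S A)
    (f' : A ~> G) (g' : G ~> E) (h' : E ~> S A)
    (alpha : M ~> G) (beta : G ~> B) (gamma : B ~> S M)
    (delta : M ~> E) (epsilon : E ~> D) (zeta : D ~> S M) : Prop :=
  BaseChangeDiagram {
  bc_row1 : Delta (Triangle f' g' h');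
  bc_row2 : Delta (Triangle f g h);
  bc_col1 : Delta (Triangle alpha beta gamma);
  bc_col2 : Delta (Triangle delta epsilon zeta);
  bc_fE : beta ∘ f' = f;
  bc_gE : g ∘ beta = epsilon ∘ g';
  bc_hE : h' = h ∘ epsilon;
  bc_deltaE : g' ∘ alpha = delta;
  bc_gammaE : gamma = zeta ∘ g }.

Definition closed_base_change (xi : triangle_class S) : Prop :=
  forall (A B D E G M : C)
    (f : A ~> B) (g : B ~> D) (h : D ~> S A)
    (f' : A ~> G) (g' : G ~> E) (h' : E ~> S A)
    (alpha : M ~> G) (beta : G ~> B) (gamma : B ~> S M)
    (delta : M ~> E) (epsilon : E ~> D) (zeta : D ~> S M),
  base_change_diagram f g h f' g' h' alpha beta gamma delta epsilon zeta ->
  xi (Triangle f g h) -> xi (Triangle f' g' h').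

Definition saturated (xi : triangle_class S) : Prop :=
  forall (A B D E G M : C)
    (f : A ~> B) (g : B ~> D) (h : D ~> S A)
    (f' : A ~> G) (g' : G ~> E) (h' : E ~> S A)
    (alpha : M ~> G) (beta : G ~> B) (gamma : B ~> S M)
    (delta : M ~> E) (epsilon : E ~> D) (zeta : D ~> S M),
  base_change_diagram f g h f' g' h' alpha beta gamma delta epsilon zeta ->
  xi (Triangle delta epsilon zeta) -> xi (Triangle f' g' h') ->
  xi (Triangle f g h).

(* Up to isomorphism, the triangle obtained from (f, g, h) by cobase change
   along alpha is the one on (Sigma alpha) h. *)
Definition closed_cobase_change (xi : triangle_class S) : Prop :=
  forall (A B D E F : C) (f : A ~> B) (g : B ~> D) (h : D ~> S A)
    (alpha : A ~> E) (f' : E ~> F) (g' : F ~> D),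
  xi (Triangle f g h) -> Delta (Triangle f' g' (fmap S alpha ∘ h)) ->
  xi (Triangle f' g' (fmap S alpha ∘ h)).

(* For finite coproducts binary ones suffice: the empty one, the zero
   triangle, is split. *)
Record proper_class (xi : triangle_class S) : Prop := ProperClass {
  pc_sub : forall T, xi T -> Delta T;
  pc_split : forall T, split_triangle T -> xi T;
  pc_iso : forall T T', triangle_iso T T' -> xi T -> xi T';
  pc_sum : forall T T' (SA : biproduct (tA T) (tA T'))
      (SB : biproduct (tB T) (tB T')) (SC : biproduct (tC T) (tC T')),
    xi T -> xi T' -> xi (triangle_sum SA SB SC);
  pc_suspension : forall (i : int) T, xi T -> xi (suspension i T);
  pc_saturated : saturated xi;
  pc_base_change : closed_base_change xi;
  pc_cobase_change : closed_cobase_change xi }.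

Definition surj (U V : Type) (u : U -> V) : Prop := forall y, exists x, u x = y.

Definition short_exact (U V W : zmodType) (u : U -> V) (v : V -> W) : Prop :=
  [/\ injective u, forall y, v y = 0 <-> exists x, u x = y & surj v].

Definition xi_projective (xi : triangle_class S) (P : C) : Prop :=
  forall T, xi T -> short_exact (fun u : P ~> tA T => tf T ∘ u)
                                (fun v : P ~> tB T => tg T ∘ v).

Definition xi_injective (xi : triangle_class S) (I : C) : Prop :=
  forall T, xi T -> short_exact (fun u : tC T ~> I => u ∘ tg T)
                                (fun v : tB T ~> I => v ∘ tf T).

Definition enough_projectives (xi : triangle_class S) : Prop :=
  forall A : C, exists (K P : C) (f : K ~> P) (g : P ~> A) (h : A ~> S K),
    xi (Triangle f g h) /\ xi_projective xi P.

Definition enough_injectives (xi : triangle_class S) : Prop :=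
  forall A : C, exists (I K : C) (f : A ~> I) (g : I ~> K) (h : K ~> S A),
    xi (Triangle f g h) /\ xi_injective xi I.

(* A full subcategory is given by its objects. *)
Definition subcategory := C -> Prop.

Definition xi_proj (X : subcategory) : triangle_class S := fun T =>
  Delta T /\ forall P, X P ->
    injective (fun u : P ~> tA T => tf T ∘ u) /\
    surj (fun v : P ~> tB T => tg T ∘ v).

Definition xi_inj (Y : subcategory) : triangle_class S := fun T =>
  Delta T /\ forall I, Y I ->
    injective (fun u : tC T ~> I => u ∘ tg T) /\
    surj (fun v : tB T ~> I => v ∘ tf T).

Record additive_subcategory (X : subcategory) : Prop := AdditiveSubcategory {
  as_zero : exists2 Z, is_zero Z & X Z;
  as_sum : forall (A B : C) (AB : biproduct A B), X A -> X B -> X AB }.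

(* Sigma X = X, up to isomorphism. *)
Definition sigma_stable (X : subcategory) : Prop :=
  (forall A, X A -> X (S A)) /\
  (forall A, X A -> exists2 B, X B & isomorphic A (S B)).

Definition summand_closed (X : subcategory) : Prop :=
  forall (A B : C) (AB : biproduct A B), X AB -> X A /\ X B.

Definition augment (M : C) (Z : nat -> C) (n : nat) : C :=
  if n is m.+1 then Z m else M.

(* ... -> X 1 -> X 0 -> M is xi-exact; [K n] stands for K_{n+1}, and K_0 = M. *)
Definition exact_resolution (xi : triangle_class S) (M : C) (X : nat -> C)
    (d : forall n, X n ~> augment M X n) : Prop :=
  exists (K : nat -> C) (g : forall n, K n ~> X n)
         (f : forall n, X n ~> augment M K n)
         (h : forall n, augment M K n ~> S (K n)),
  forall n, xi (Triangle (g n) (f n) (h n)) /\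
    d n = match n return augment M K n ~> augment M X n with
          | 0 => idm M
          | m.+1 => g m
          end ∘ f n.

(* M -> Y 0 -> Y 1 -> ... is xi-exact, with descending indices reversed:
   [Y n] stands for Y_{-n}, and [K n] is the target of Y n. *)
Definition exact_coresolution (xi : triangle_class S) (M : C) (Y : nat -> C)
    (d : forall n, augment M Y n ~> Y n) : Prop :=
  exists (K : nat -> C) (g : forall n, augment M K n ~> Y n)
         (f : forall n, Y n ~> K n)
         (h : forall n, K n ~> S (augment M K n)),
  forall n, xi (Triangle (g n) (f n) (h n)) /\
    d n = g n ∘ match n return augment M Y n ~> augment M K n with
                | 0 => idm M
                | m.+1 => f m
                end.

Definition has_exact_resolution (X Y : subcategory) (M : C) : Prop :=
  exists (Z : nat -> C) (d : forall n, Z n ~> augment M Z n),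
    (forall n, X (Z n)) /\
    exact_resolution (fun T => xi_proj X T /\ xi_inj Y T) d.

Definition has_exact_coresolution (X Y : subcategory) (N : C) : Prop :=
  exists (Z : nat -> C) (d : forall n, augment N Z n ~> Z n),
    (forall n, Y (Z n)) /\
    exact_coresolution (fun T => xi_inj Y T /\ xi_proj X T) d.

Definition contravariantly_finite (X : subcategory) : Prop :=
  forall A : C, exists (P : C) (p : P ~> A), X P /\
    forall P', X P' -> surj (fun u : P' ~> P => p ∘ u).

Definition covariantly_finite (Y : subcategory) : Prop :=
  forall A : C, exists (I : C) (i : A ~> I), Y I /\
    forall I', Y I' -> surj (fun u : I ~> I' => u ∘ i).

Definition balanced_cond1 (X Y : subcategory) : Prop :=
  [/\ forall T, xi_proj X T <-> xi_inj Y T,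
      forall A, X A <-> xi_projective (xi_proj X) A,
      forall A, Y A <-> xi_injective (xi_inj Y) A,
      enough_projectives (xi_proj X)
    & enough_injectives (xi_inj Y)].

Definition balanced_cond2 (X Y : subcategory) : Prop :=
  [/\ contravariantly_finite X, covariantly_finite Y,
      forall M, has_exact_resolution X Y M
    & forall N, has_exact_coresolution X Y N].

(* The two conditions are equivalent; either may be used to establish that a
   pair is balanced. *)
Record balanced_pair (X Y : subcategory) : Prop := BalancedPair {
  bp_addX : additive_subcategory X;
  bp_addY : additive_subcategory Y;
  bp_stableX : sigma_stable X;
  bp_stableY : sigma_stable Y;
  bp_summandX : summand_closed X;
  bp_summandY : summand_closed Y;
  bp_cond : balanced_cond1 X Y \/ balanced_cond2 X Y }.

End ProperClass.

(* [E D A] is the group E(D, A), contravariant in [D]. *)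
Record bifunctor (C : preadditive) := Bifunctor {
  ext :> C -> C -> zmodType;
  push : forall D A A' : C, A ~> A' -> ext D A -> ext D A';
  pull : forall D' D A : C, D' ~> D -> ext D A -> ext D' A;
  push1 : forall D A (x : ext D A), push (idm A) x = x;
  pull1 : forall D A (x : ext D A), pull (idm D) x = x;
  pushM : forall D A A' A'' (b : A' ~> A'') (a : A ~> A') (x : ext D A),
    push (b ∘ a) x = push b (push a x);
  pullM : forall D'' D' D A (c : D' ~> D) (d : D'' ~> D') (x : ext D A),
    pull (c ∘ d) x = pull d (pull c x);
  push_pull : forall D' D A A' (a : A ~> A') (c : D' ~> D) (x : ext D A),
    push a (pull c x) = pull c (push a x);
  pushD : forall D A A' (a : A ~> A') (x y : ext D A),
    push a (x + y) = push a x + push a y;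
  pullD : forall D' D A (c : D' ~> D) (x y : ext D A),
    pull c (x + y) = pull c x + pull c y;
  pushDl : forall D A A' (a a' : A ~> A') (x : ext D A),
    push (a + a') x = push a x + push a' x;
  pullDl : forall D' D A (c c' : D' ~> D) (x : ext D A),
    pull (c + c') x = pull c x + pull c' x }.

Arguments push {C} _ {D A A'} _ _.
Arguments pull {C} _ {D' D A} _ _.

Program Definition hom_bifunctor (C : preadditive) (S : autoequivalence C) :
    bifunctor C :=
  @Bifunctor C (fun D A => (D ~> S A))
    (fun D A A' a x => fmap S a ∘ x) (fun D' D A c x => x ∘ c)
    _ _ _ _ _ _ _ _ _.
Next Obligation. by rewrite fmap1 compose1m. Qed.
Next Obligation. by rewrite composem1. Qed.
Next Obligation. by rewrite fmapM composeA. Qed.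
Next Obligation. by rewrite composeA. Qed.
Next Obligation. by rewrite composeA. Qed.
Next Obligation. by rewrite composeDr. Qed.
Next Obligation. by rewrite composeDl. Qed.
Next Obligation. by rewrite fmapD composeDl. Qed.
Next Obligation. by rewrite composeDr. Qed.

Section Subgroup.
Variables (V : zmodType) (P : V -> Prop).

Definition subgroup_closed : Prop := P 0 /\ forall x y, P x -> P y -> P (x - y).

(* [subgroup_closed] is an argument so that it can be used to derive the group
   structure of the subtype. *)
Definition subgroup_pred (_ : subgroup_closed) : {pred V} := fun x => `[< P x >].

Variable Pclosed : subgroup_closed.

Definition subgroup : Type := {x : V | x \in subgroup_pred Pclosed}.

Lemma subgroup_zmod_closed : zmod_closed (subgroup_pred Pclosed).
Proof.
case: Pclosed => P0 PB; split; first exact/asboolP.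
by move=> x y /asboolP Px /asboolP Py; apply/asboolP; apply: PB.
Qed.

HB.instance Definition _ :=
  GRing.isZmodClosed.Build V (subgroup_pred Pclosed) subgroup_zmod_closed.
HB.instance Definition _ := SubChoice.on subgroup.
HB.instance Definition _ := [SubChoice_isSubZmodule of subgroup by <:].

Lemma subgroupP (x : subgroup) : P (val x).
Proof. exact/asboolP/(valP x). Qed.

Definition subgroup_elt (x : V) (Px : P x) : subgroup :=
  exist _ x (introT (asboolP (P x)) Px).
End Subgroup.

Section Subbifunctor.
Variables (C : preadditive) (E : bifunctor C).
Variable P : forall D A : C, E D A -> Prop.

Record subbifunctor_closed : Prop := SubbifunctorClosed {
  sub_group : forall D A, subgroup_closed (@P D A);
  sub_push : forall D A A' (a : A ~> A') (x : E D A), P x -> P (push E a x);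
  sub_pull : forall D' D A (c : D' ~> D) (x : E D A), P x -> P (pull E c x) }.

Variable H : subbifunctor_closed.

Definition sub_ext (D A : C) : zmodType := subgroup (sub_group H D A).

Program Definition subbifunctor : bifunctor C :=
  @Bifunctor C sub_ext
    (fun D A A' a x => subgroup_elt _ (sub_push H a (subgroupP x)))
    (fun D' D A c x => subgroup_elt _ (sub_pull H c (subgroupP x)))
    _ _ _ _ _ _ _ _ _.
Next Obligation. by apply: val_inj; rewrite /= push1. Qed.
Next Obligation. by apply: val_inj; rewrite /= pull1. Qed.
Next Obligation. by apply: val_inj; rewrite /= pushM. Qed.
Next Obligation. by apply: val_inj; rewrite /= pullM. Qed.
Next Obligation. by apply: val_inj; rewrite /= push_pull. Qed.
Next Obligation. by apply: val_inj; rewrite /= pushD. Qed.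
Next Obligation. by apply: val_inj; rewrite /= pullD. Qed.
Next Obligation. by apply: val_inj; rewrite /= pushDl. Qed.
Next Obligation. by apply: val_inj; rewrite /= pullDl. Qed.
End Subbifunctor.

Section Sequences.
Variable C : preadditive.

Record sequence (A D : C) := Sequence {
  mid : C;
  sx : A ~> mid;
  sy : mid ~> D }.

Definition seq_equiv (A D : C) (q q' : sequence A D) : Prop :=
  exists b : mid q ~> mid q', [/\ is_iso b, b ∘ sx q = sx q' & sy q' ∘ b = sy q].

Definition seq_sum (A D A' D' : C) (q : sequence A D) (q' : sequence A' D')
    (SA : biproduct A A') (SB : biproduct (mid q) (mid q'))
    (SD : biproduct D D') : sequence SA SD :=
  Sequence (dsum SA SB (sx q) (sx q')) (dsum SB SD (sy q) (sy q')).

Variable E : bifunctor C.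

(* [s D A x] is the equivalence class s(x), as a set of sequences. *)
Definition realization_map := forall D A : C, E D A -> sequence A D -> Prop.

Definition ext_sum (A D A' D' : C) (x : E D A) (x' : E D' A')
    (SA : biproduct A A') (SD : biproduct D D') : E SD SA :=
  push E (in1 SA) (pull E (pr1 SD) x) + push E (in2 SA) (pull E (pr2 SD) x').

Record realization (s : realization_map) : Prop := Realization {
  rz_class : forall D A (x : E D A),
    exists q, forall q', s D A x q' <-> seq_equiv q q';
  rz_morphism : forall D A D' A' (x : E D A) (x' : E D' A') q q',
    s D A x q -> s D' A' x' q' ->
    forall (a : A ~> A') (c : D ~> D'), push E a x = pull E c x' ->
    exists b : mid q ~> mid q', b ∘ sx q = sx q' ∘ a /\ sy q' ∘ b = c ∘ sy q }.

Record additive_realization (s : realization_map) : Prop := AdditiveRealization {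
  ar_realization :> realization s;
  ar_zero : forall D A (S : biproduct A D),
    s D A 0 (Sequence (in1 S) (pr2 S));
  ar_sum : forall D A D' A' (x : E D A) (x' : E D' A') q q'
      (SA : biproduct A A') (SB : biproduct (mid q) (mid q'))
      (SD : biproduct D D'),
    s D A x q -> s D' A' x' q' ->
    s SD SA (ext_sum x x' SA SD) (seq_sum SA SB SD) }.

End Sequences.

Record extriangulated (C : additive_category) (E : bifunctor C)
    (s : realization_map E) : Prop := Extriangulated {
  et2 : additive_realization s;
  et3 : forall D A D' A' (x : E D A) (x' : E D' A') q q',
    s D A x q -> s D' A' x' q' ->
    forall (a : A ~> A') (b : mid q ~> mid q'), b ∘ sx q = sx q' ∘ a ->
    exists c : D ~> D', c ∘ sy q = sy q' ∘ b /\ push E a x = pull E c x';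
  et3op : forall D A D' A' (x : E D A) (x' : E D' A') q q',
    s D A x q -> s D' A' x' q' ->
    forall (b : mid q ~> mid q') (c : D ~> D'), c ∘ sy q = sy q' ∘ b ->
    exists a : A ~> A', b ∘ sx q = sx q' ∘ a /\ push E a x = pull E c x';
  et4 : forall (A B D F G : C) (x : E D A) (x' : E F B)
      (f : A ~> B) (f' : B ~> D) (g : B ~> G) (g' : G ~> F),
    s D A x (Sequence f f') -> s F B x' (Sequence g g') ->
    exists (K : C) (h' : G ~> K) (d : D ~> K) (e : K ~> F) (x'' : E K A),
      [/\ h' ∘ g = d ∘ f' & e ∘ h' = g'] /\
      [/\ s K A x'' (Sequence (g ∘ f) h'),
          s F D (push E f' x') (Sequence d e),
          pull E d x'' = x
        & push E f x'' = pull E e x'];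
  et4op : forall (A B D F G : C) (x : E B D) (x' : E G F)
      (f' : D ~> A) (f : A ~> B) (g' : F ~> B) (g : B ~> G),
    s B D x (Sequence f' f) -> s G F x' (Sequence g' g) ->
    exists (K : C) (h' : K ~> A) (d : D ~> K) (e : K ~> F) (x'' : E G K),
      [/\ h' ∘ d = f' & f ∘ h' = g' ∘ e] /\
      [/\ s G K x'' (Sequence h' (g ∘ f)),
          s F D (pull E g' x) (Sequence d e),
          x' = push E e x''
        & push E d x = pull E g x''] }.

Definition is_triangulated_category (C : additive_category) (E : bifunctor C)
    (s : realization_map E) : Prop :=
  exists (S : autoequivalence C) (Delta : triangle_class S)
         (phi : forall D A : C, E D A -> (D ~> S A)),
  [/\ triangulated Delta,
      forall D A, bijective (phi D A),
      forall D A (x y : E D A), phi D A (x + y) = phi D A x + phi D A y,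
      (forall D A A' (a : A ~> A') (x : E D A),
         phi D A' (push E a x) = fmap S a ∘ phi D A x) /\
      (forall D' D A (c : D' ~> D) (x : E D A),
         phi D' A (pull E c x) = phi D A x ∘ c)
    & forall D A (x : E D A) (q : sequence A D),
        s D A x q <-> Delta (Triangle (sx q) (sy q) (phi D A x))].

Section Exact.
Variable C : additive_category.

Definition is_kernel (A B D : C) (x : A ~> B) (y : B ~> D) : Prop :=
  y ∘ x = 0 /\ forall W (u : W ~> B), y ∘ u = 0 -> exists! v : W ~> A, x ∘ v = u.

Definition is_cokernel (A B D : C) (x : A ~> B) (y : B ~> D) : Prop :=
  y ∘ x = 0 /\ forall W (u : B ~> W), u ∘ x = 0 -> exists! v : D ~> W, v ∘ y = u.

Definition is_pushout (A B A' B' : C) (x : A ~> B) (a : A ~> A')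
    (x' : A' ~> B') (b : B ~> B') : Prop :=
  b ∘ x = x' ∘ a /\
  forall W (u : B ~> W) (v : A' ~> W), u ∘ x = v ∘ a ->
    exists! w : B' ~> W, w ∘ b = u /\ w ∘ x' = v.

Definition is_pullback (B D B' D' : C) (y : B ~> D) (c : D' ~> D)
    (y' : B' ~> D') (b : B' ~> B) : Prop :=
  y ∘ b = c ∘ y' /\
  forall W (u : W ~> B) (v : W ~> D'), y ∘ u = c ∘ v ->
    exists! w : W ~> B', b ∘ w = u /\ y' ∘ w = v.

Definition sequence_class := forall A D : C, sequence A D -> Prop.

Variable K : sequence_class.

Definition admissible_mono (A B : C) (x : A ~> B) : Prop :=
  exists (D : C) (y : B ~> D), K (Sequence x y).

Definition admissible_epi (B D : C) (y : B ~> D) : Prop :=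
  exists (A : C) (x : A ~> B), K (Sequence x y).

Record exact_structure : Prop := ExactStructure {
  ex_kernel : forall A D (q : sequence A D),
    K q -> is_kernel (sx q) (sy q) /\ is_cokernel (sx q) (sy q);
  ex_iso : forall A D A' D' (q : sequence A D) (q' : sequence A' D')
      (a : A ~> A') (b : mid q ~> mid q') (c : D ~> D'),
    is_iso a -> is_iso b -> is_iso c ->
    b ∘ sx q = sx q' ∘ a -> c ∘ sy q = sy q' ∘ b -> K q -> K q';
  ex_id_mono : forall A : C, admissible_mono (idm A);
  ex_id_epi : forall A : C, admissible_epi (idm A);
  ex_comp_mono : forall (A B D : C) (f : A ~> B) (g : B ~> D),
    admissible_mono f -> admissible_mono g -> admissible_mono (g ∘ f);
  ex_comp_epi : forall (A B D : C) (f : A ~> B) (g : B ~> D),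
    admissible_epi f -> admissible_epi g -> admissible_epi (g ∘ f);
  ex_pushout : forall (A B A' : C) (x : A ~> B) (a : A ~> A'),
    admissible_mono x ->
    exists (B' : C) (x' : A' ~> B') (b : B ~> B'),
      is_pushout x a x' b /\ admissible_mono x';
  ex_pullback : forall (B D D' : C) (y : B ~> D) (c : D' ~> D),
    admissible_epi y ->
    exists (B' : C) (y' : B' ~> D') (b : B' ~> B),
      is_pullback y c y' b /\ admissible_epi y' }.

(* Yoneda operations on Ext^1: q' represents a_* [q], resp. c^* [q], resp. q3
   represents the Baer sum [q1] + [q2]. *)
Definition yoneda_push (A A' D : C) (a : A ~> A') (q : sequence A D)
    (q' : sequence A' D) : Prop :=
  K q' /\ exists b : mid q ~> mid q', is_pushout (sx q) a (sx q') b /\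
    sy q' ∘ b = sy q.

Definition yoneda_pull (A D D' : C) (c : D' ~> D) (q : sequence A D)
    (q' : sequence A D') : Prop :=
  K q' /\ exists b : mid q' ~> mid q, is_pullback (sy q) c (sy q') b /\
    b ∘ sx q' = sx q.

Definition baer_sum (A D : C) (q1 q2 q3 : sequence A D) : Prop :=
  exists (SA : biproduct A A) (SB : biproduct (mid q1) (mid q2))
         (SD : biproduct D D) (q : sequence SA D),
    yoneda_pull (in1 SD + in2 SD) (seq_sum SA SB SD) q /\
    yoneda_push (pr1 SA + pr2 SA) q q3.

End Exact.

(* The structure (E, s) comes from an exact structure: the conflations form an
   exact structure, and s induces an isomorphism of bifunctors from E to
   Ext^1, the group of conflations up to equivalence. *)
Section ExactCategory.
Variables (C : additive_category) (E : bifunctor C) (s : realization_map E).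

Definition conflation : sequence_class C :=
  fun A D (q : sequence A D) => exists x : E D A, s x q.

Record is_exact_category : Prop := IsExactCategory {
  iec_exact : exact_structure conflation;
  iec_class : forall D A (x : E D A),
    exists q, forall q', s x q' <-> seq_equiv q q';
  iec_inj : forall D A (x y : E D A) q, s x q -> s y q -> x = y;
  iec_push : forall D A A' (a : A ~> A') (x : E D A) q q',
    s x q -> s (push E a x) q' -> yoneda_push conflation a q q';
  iec_pull : forall D' D A (c : D' ~> D) (x : E D A) q q',
    s x q -> s (pull E c x) q' -> yoneda_pull conflation c q q';
  iec_add : forall D A (x y : E D A) q1 q2 q3,
    s x q1 -> s y q2 -> s (x + y) q3 ->
    baer_sum conflation q1 q2 q3 }.

End ExactCategory.

Section Relative.
Variables (C : additive_category) (S : autoequivalence C).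
Variables (Delta xi : triangle_class S).

(* x |-> [A -> B -> D], where A -> B -> D -x-> Sigma A is distinguished. *)
Definition triangle_realization : realization_map (hom_bifunctor S) :=
  fun D A x q => exists2 q0 : sequence A D,
    Delta (@Triangle _ S _ _ _ (sx q0) (sy q0) x) & seq_equiv q0 q.

Definition in_E_xi (D A : C) (x : hom_bifunctor S D A) : Prop :=
  exists2 q : sequence A D, triangle_realization x q &
    xi (@Triangle _ S _ _ _ (sx q) (sy q) x).

Hypothesis E_xi_closed : subbifunctor_closed in_E_xi.

Definition E_xi : bifunctor C := subbifunctor E_xi_closed.

Definition s_xi : realization_map E_xi :=
  fun D A x q => triangle_realization (val x) q.

End Relative.

Arguments s_xi {C S Delta xi} E_xi_closed D A _ _.

(* Main.v *)
From mathcomp Require Import all_boot all_algebra.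
Require Import Defs.

Set Implicit Arguments.
Unset Strict Implicit.
Unset Printing Implicit Defensive.

Import GRing.Theory.
Local Open Scope ring_scope.

(** Everything rests on reading membership in the class off the third map. Call
    [x : D ~> B] a ghost if it is killed by every map from an object of [X].
    A distinguished triangle [(f, g, h)] is [X]-exact exactly when [h] is a
    ghost ([xi_projE]), and dually it is [Y]-exact exactly when [h] is a
    coghost, that is, when its composites with all maps [S A ~> S I], [I] in
    [Y], vanish ([xi_injE]). Ghosts form a two-sided ideal, stable under
    suspension and desuspension. So they form an additive subbifunctor of
    [Hom(-, S -)] ([ghost_subbifunctor]), and the axioms of a proper class
    reduce to short computations with third maps ([xi_proj_proper]).

    Both forms of the definition of a balanced pair put every object [M] in a
    triangle [K -> P -> M] with [P] in [X], and in a triangle [M -> I -> K]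
    with [I] in [Y], whose third maps are both ghosts and coghosts
    ([balanced_left], [balanced_right]). A ghost on [M] vanishes on [P], hence
    factors through the third map of the first triangle and is a coghost; the
    converse is dual ([balanced_xiE]).

    The axioms of an extriangulated category are those of the triangulated
    category, transported along the full and faithful suspension; what is left
    to prove is that the extensions produced by the octahedral axiom are again
    ghosts, and this follows from the exactness of [Hom(P, -)]
    ([s_xi_extriangulated]). This part works for every [X] stable under
    suspension.

    If the relative structure is triangulated, then [A -> 0 -> S' A] is a
    conflation, and its exactness under [Hom(X, -)] and [Hom(-, Y)] kills [X]
    and [Y]; if [X = 0], every map is a ghost and the whole triangulated
    structure is recovered ([balanced_triangulated], [zero_triangulated]). If
    the relative structure is exact, then in a triangle [(f, g, h)] of the class
    [g] is an epimorphism, so [h ∘ g = 0] forces [h = 0]: ghosts vanish,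
    the triangles above split, and every [M] is a summand of an object of [X]
    and of an object of [Y] ([balanced_exact]). Conversely, if [X] is everything
    then a ghost vanishes because it vanishes on the identity, the conflations
    are the split sequences, and these form an exact structure with zero
    extension groups ([split_is_exact_category]). *)

(** * Preadditive categories *)

Section PreadditiveTheory.
Variable C : preadditive.

Lemma composeNl (A B D : C) (g : B ~> D) (f : A ~> B) : (- g) ∘ f = - (g ∘ f).
Proof. by apply: (addrI (g ∘ f)); rewrite -composeDl !subrr compose0l. Qed.

Lemma composeNr (A B D : C) (g : B ~> D) (f : A ~> B) : g ∘ (- f) = - (g ∘ f).
Proof. by apply: (addrI (g ∘ f)); rewrite -composeDr !subrr compose0r. Qed.

Lemma composeBl (A B D : C) (g g' : B ~> D) (f : A ~> B) :
  (g - g') ∘ f = g ∘ f - g' ∘ f.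
Proof. by rewrite composeDl composeNl. Qed.

Lemma composeBr (A B D : C) (g : B ~> D) (f f' : A ~> B) :
  g ∘ (f - f') = g ∘ f - g ∘ f'.
Proof. by rewrite composeDr composeNr. Qed.

Lemma fmapN (F : endofunctor C) (A B : C) (f : A ~> B) :
  fmap F (- f) = - fmap F f.
Proof. by apply: (addrI (fmap F f)); rewrite -fmapD !subrr fmap0. Qed.

Lemma is_iso_idm (A : C) : is_iso (idm A).
Proof. by exists (idm A); rewrite compose1m. Qed.

Lemma is_iso_opp (A B : C) (f : A ~> B) : is_iso f -> is_iso (- f).
Proof.
by case=> g [gf fg]; exists (- g); rewrite !composeNl !composeNr !opprK.
Qed.

Lemma zero_of_idm (A : C) : idm A = 0 -> is_zero A.
Proof.
move=> id0 B; split=> f.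
  by rewrite -(composem1 f) id0 compose0r.
by rewrite -(compose1m f) id0 compose0l.
Qed.

Lemma fmap_zero (F : endofunctor C) (Z : C) : is_zero Z -> is_zero (F Z).
Proof.
move=> Z0; apply: zero_of_idm.
by rewrite -fmap1 (proj1 (Z0 Z) (idm Z)) fmap0.
Qed.

Section DirectSums.
Variables (A B A' B' A'' B'' : C).
Variables (S : biproduct A B) (S' : biproduct A' B') (S'' : biproduct A'' B'').

Lemma dsum_in1 (f : A ~> A') (g : B ~> B') : dsum S S' f g ∘ in1 S = in1 S' ∘ f.
Proof.
by rewrite composeDl -!composeA pr1_in1 pr2_in1 !compose0r composem1 addr0.
Qed.

Lemma dsum_in2 (f : A ~> A') (g : B ~> B') : dsum S S' f g ∘ in2 S = in2 S' ∘ g.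
Proof.
by rewrite composeDl -!composeA pr1_in2 pr2_in2 !compose0r composem1 add0r.
Qed.

Lemma pr1_dsum (f : A ~> A') (g : B ~> B') : pr1 S' ∘ dsum S S' f g = f ∘ pr1 S.
Proof.
by rewrite composeDr !composeA pr1_in1 pr1_in2 !compose0l compose1m addr0.
Qed.

Lemma pr2_dsum (f : A ~> A') (g : B ~> B') : pr2 S' ∘ dsum S S' f g = g ∘ pr2 S.
Proof.
by rewrite composeDr !composeA pr2_in1 pr2_in2 !compose0l compose1m add0r.
Qed.

Lemma bip_coext (W : C) (u v : S ~> W) :
  u ∘ in1 S = v ∘ in1 S -> u ∘ in2 S = v ∘ in2 S -> u = v.
Proof.
move=> e1 e2; rewrite -(composem1 u) -(composem1 v) -(in_pr S) !composeDr.
by rewrite !composeA e1 e2.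
Qed.

Lemma dsum0 : dsum S S' (0 : A ~> A') (0 : B ~> B') = 0.
Proof. by rewrite /dsum !compose0r !compose0l addr0. Qed.

Lemma fmap_dsum (F : endofunctor C) (f : A ~> A') (g : B ~> B') :
  fmap F (dsum S S' f g) =
  dsum (fmap_biproduct F S) (fmap_biproduct F S') (fmap F f) (fmap F g).
Proof. by rewrite /dsum fmapD !fmapM. Qed.

End DirectSums.

Lemma dsumM (A B D A' B' D' : C) (SA : biproduct A A') (SB : biproduct B B')
    (SD : biproduct D D') (f : A ~> B) (f' : A' ~> B') (g : B ~> D)
    (g' : B' ~> D') :
  dsum SB SD g g' ∘ dsum SA SB f f' = dsum SA SD (g ∘ f) (g' ∘ f').
Proof.
apply: bip_coext; first by rewrite -composeA !dsum_in1 composeA dsum_in1 composeA.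
by rewrite -composeA !dsum_in2 composeA dsum_in2 composeA.
Qed.

(** Weak kernels are compatible with direct sums: a map into the sum is killed
    componentwise, hence lifts componentwise. *)
Lemma dsum_exact (A B D A' B' D' : C) (f : A ~> B) (g : B ~> D)
    (f' : A' ~> B') (g' : B' ~> D') (SA : biproduct A A') (SB : biproduct B B')
    (SD : biproduct D D') (W : C) :
  (forall v : W ~> B, g ∘ v = 0 -> exists u, v = f ∘ u) ->
  (forall v : W ~> B', g' ∘ v = 0 -> exists u, v = f' ∘ u) ->
  forall v : W ~> SB, dsum SB SD g g' ∘ v = 0 ->
  exists u, v = dsum SA SB f f' ∘ u.
Proof.
move=> ex ex' v v0.
have [|u1 e1] := ex (pr1 SB ∘ v).
  by rewrite composeA -(pr1_dsum SB SD g g') -composeA v0 compose0r.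
have [|u2 e2] := ex' (pr2 SB ∘ v).
  by rewrite composeA -(pr2_dsum SB SD g g') -composeA v0 compose0r.
exists (in1 SA ∘ u1 + in2 SA ∘ u2).
rewrite -(compose1m v) -(in_pr SB) composeDl -!composeA e1 e2 composeDr.
by rewrite !composeA dsum_in1 dsum_in2.
Qed.

End PreadditiveTheory.

(** * Split short exact sequences *)

Section Splittings.
Variable C : additive_category.

(** [r] and [s] exhibit [B] as a biproduct of [A] and [D]; [y ∘ x = 0] and
    [r ∘ s = 0] follow from the three equations. *)
Definition splitting (A B D : C) (x : A ~> B) (y : B ~> D)
    (r : B ~> A) (s : D ~> B) : Prop :=
  [/\ r ∘ x = idm A, y ∘ s = idm D & x ∘ r + s ∘ y = idm B].

Lemma splitting_yx (A B D : C) (x : A ~> B) (y : B ~> D) r s :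
  splitting x y r s -> y ∘ x = 0.
Proof.
case=> rx ys e.
have: y ∘ (x ∘ r + s ∘ y) ∘ x = y ∘ x by rewrite e composem1.
rewrite composeDr composeDl !composeA ys compose1m -(composeA _ r x) rx composem1.
by move=> h; apply: (addrI (y ∘ x)); rewrite h addr0.
Qed.

Lemma splitting_rs (A B D : C) (x : A ~> B) (y : B ~> D) r s :
  splitting x y r s -> r ∘ s = 0.
Proof.
case=> rx ys e.
have: r ∘ (x ∘ r + s ∘ y) ∘ s = r ∘ s by rewrite e composem1.
rewrite composeDr composeDl !composeA rx compose1m -(composeA _ y s) ys composem1.
by move=> h; apply: (addrI (r ∘ s)); rewrite h addr0.
Qed.

Definition splitting_biproduct (A B D : C) (x : A ~> B) (y : B ~> D) r s
    (H : splitting x y r s) : biproduct A D :=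
  @Biproduct C A D B x s r y (let: And3 rx _ _ := H in rx)
    (let: And3 _ ys _ := H in ys) (splitting_rs H) (splitting_yx H)
    (let: And3 _ _ e := H in e).

Lemma biproduct_splitting (A D : C) (S : biproduct A D) :
  splitting (in1 S) (pr2 S) (pr1 S) (in2 S).
Proof. by split; rewrite ?pr1_in1 ?pr2_in2 ?in_pr. Qed.

Lemma splitting_kernel (A B D : C) (x : A ~> B) (y : B ~> D) r s :
  splitting x y r s -> is_kernel x y.
Proof.
move=> H; split; first exact: splitting_yx H.
case: (H) => rx ys e W u u0; exists (r ∘ u); split.
  rewrite -[RHS]compose1m -e composeDl -(composeA s y u) u0 compose0r addr0.
  by rewrite composeA.
by move=> v <-; rewrite composeA rx compose1m.
Qed.

Lemma splitting_cokernel (A B D : C) (x : A ~> B) (y : B ~> D) r s :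
  splitting x y r s -> is_cokernel x y.
Proof.
move=> H; split; first exact: splitting_yx H.
case: (H) => rx ys e W u u0; exists (u ∘ s); split.
  rewrite -[RHS]composem1 -e composeDr (composeA u x r) u0 compose0l add0r.
  by rewrite composeA.
by move=> v <-; rewrite -composeA ys composem1.
Qed.

(** With [s] a section of [y], the map [b ∘ s] is a section of [y'], so [B'] is
    [A'] plus a copy of [D] on which a map out of the pushout is prescribed by
    its value on [B]. *)
Lemma splitting_pushout (A B D A' B' : C) (x : A ~> B) (y : B ~> D) r s
    (x' : A' ~> B') (y' : B' ~> D) r' s' (a : A ~> A') (b : B ~> B') :
  splitting x y r s -> splitting x' y' r' s' ->
  b ∘ x = x' ∘ a -> y' ∘ b = y -> is_pushout x a x' b.
Proof.
move=> H H' bx yb; split=> // W u v uv.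
have [rx ys e] := H; have [rx' ys' e'] := H'; have yx' := splitting_yx H'.
(* The retraction of [x'] complementary to the section [b ∘ s] of [y']. *)
pose t := r' - r' ∘ b ∘ s ∘ y'.
have x't : x' ∘ t = idm B' - b ∘ s ∘ y'.
  have xr : x' ∘ r' = idm B' - s' ∘ y' by rewrite -e' addrK.
  rewrite /t composeBr !composeA xr !composeBl !compose1m.
  rewrite -(composeA s' y' b) yb -(composeA s' y s) ys composem1.
  by rewrite opprB addrA subrK.
have tx : t ∘ x' = idm A'.
  by rewrite /t composeBl rx' -!composeA yx' !compose0r subr0.
have tb : t ∘ b = a ∘ r.
  have xr : x ∘ r = idm B - s ∘ y by rewrite -e addrK.
  rewrite -[t ∘ b]compose1m -rx' -!composeA (composeA x' t b) x't composeBl.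
  rewrite compose1m -!composeA yb -[X in X - _](composem1 b) -composeBr -xr.
  by rewrite (composeA b x r) bx !composeA rx' compose1m.
exists (v ∘ t + u ∘ s ∘ y'); split.
  rewrite !composeDl -!composeA yx' tx tb !compose0r composem1 addr0 yb.
  by split=> //; rewrite !composeA -uv -!composeA -composeDr e composem1.
move=> w [<- <-].
rewrite -!composeA x't composeBr composem1 !composeA.
by rewrite subrK.
Qed.

(** Dually, [r ∘ b] is a retraction of [x'], so [B'] is [D'] plus a copy of [A]
    on which a map into the pullback is prescribed by its component in [B]. *)
Lemma splitting_pullback (A B D B' D' : C) (x : A ~> B) (y : B ~> D) r s
    (x' : A ~> B') (y' : B' ~> D') r' s' (c : D' ~> D) (b : B' ~> B) :
  splitting x y r s -> splitting x' y' r' s' ->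
  b ∘ x' = x -> y ∘ b = c ∘ y' -> is_pullback y c y' b.
Proof.
move=> H H' bx yb; split=> // W u v uv.
have [rx ys e] := H; have [rx' ys' e'] := H'; have yx' := splitting_yx H'.
(* The section of [y'] complementary to the retraction [r ∘ b] of [x']. *)
pose t := s' - x' ∘ r ∘ b ∘ s'.
have ty' : t ∘ y' = idm B' - x' ∘ r ∘ b.
  have sy : s' ∘ y' = idm B' - x' ∘ r' by rewrite -e' (addrC (x' ∘ r')) addrK.
  rewrite /t composeBl -!composeA sy !composeBr !composem1 !composeA.
  rewrite -(composeA _ b x') bx -(composeA _ r x) rx composem1.
  by rewrite opprB addrA subrK.
have yt : y' ∘ t = idm D'.
  by rewrite /t composeBr ys' !composeA yx' !compose0l subr0.
have bt : b ∘ t = s ∘ c.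
  have sy : s ∘ y = idm B - x ∘ r by rewrite -e (addrC (x ∘ r)) addrK.
  rewrite -[b ∘ t]composem1 -ys' !composeA -(composeA b t y') ty' composeBr.
  rewrite composem1 !composeA bx -[X in X - _](compose1m b) -composeBl -sy.
  by rewrite -(composeA s y b) yb -!composeA ys' composem1.
exists (t ∘ v + x' ∘ r ∘ u); split.
  rewrite !composeDr !composeA yx' yt bt !compose0l compose1m addr0 bx.
  by split=> //; rewrite -(composeA s c v) -uv composeA -composeDl addrC e compose1m.
move=> w [<- <-].
by rewrite !composeA ty' composeBl compose1m subrK.
Qed.

End Splittings.

(** * Autoequivalences *)

Section AutoequivalenceTheory.
Variables (C : preadditive) (S : autoequivalence C).

Lemma susp_faithful (A B : C) (f g : A ~> B) : fmap S f = fmap S g -> f = g.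
Proof.
move=> e; rewrite -(compose1m f) -(compose1m g) -(etaK S B) -!composeA.
by rewrite !eta_nat e.
Qed.

(** The triangle identity makes the counit at [S A] the image of [etaV]. *)
Lemma fmap_etaV (A : C) : fmap S (etaV S A) = eps S (S A).
Proof.
rewrite -[LHS]compose1m -(triangle_id S A) -composeA -fmapM etaVK fmap1.
by rewrite composem1.
Qed.

(** The preimage of [w] is its transport along the unit; naturality of the counit
    and the triangle identity show that it works. *)
Lemma susp_full (A B : C) (w : S A ~> S B) : exists u : A ~> B, fmap S u = w.
Proof.
exists (etaV S B ∘ fmap (loops S) w ∘ eta S A).
by rewrite !fmapM fmap_etaV -eps_nat -composeA triangle_id composem1.
Qed.

Lemma eps_iso (A : C) : is_iso (eps S A).
Proof. by exists (epsV S A); rewrite epsK epsVK. Qed.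

Lemma susp_reflects_iso (A B : C) (f : A ~> B) : is_iso (fmap S f) -> is_iso f.
Proof.
case=> w; have [g <-] := susp_full w; rewrite -!fmapM -!fmap1 => -[gf fg].
by exists g; split; apply: susp_faithful.
Qed.

End AutoequivalenceTheory.

(** * Distinguished triangles *)

Section TriangulatedTheory.
Variables (C : additive_category) (S : autoequivalence C).

(** The part of the long exact sequences of Hom(W, -) that suffices for the five
    lemma. It makes sense for triangles not yet known to be distinguished. *)
Record hom_exact (A B D : C) (f : A ~> B) (g : B ~> D) (h : D ~> S A) : Prop :=
  HomExact {
  he_gf : g ∘ f = 0;
  he_fh : fmap S f ∘ h = 0;
  he_B : forall W (v : W ~> B), g ∘ v = 0 -> exists u, v = f ∘ u;
  he_D : forall W (v : W ~> D), h ∘ v = 0 -> exists u, v = g ∘ u;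
  he_SA : forall W (v : W ~> S A), fmap S f ∘ v = 0 -> exists u, v = h ∘ u }.

(** The five lemma, by chasing maps instead of elements: lifting the identity of
    [D'] gives a right inverse of [c], and [c] is left cancellable. *)
Lemma hom_exact_iso (A B D D' : C) (f : A ~> B) (g : B ~> D) (h : D ~> S A)
    (g' : B ~> D') (h' : D' ~> S A) (c : D ~> D') :
  hom_exact f g h -> hom_exact f g' h' -> c ∘ g = g' -> h' ∘ c = h -> is_iso c.
Proof.
move=> ex ex' cg hc.
have c_epi : exists d, c ∘ d = idm D'.
  have [d e] := he_SA ex (he_fh ex').
  have [|u eu] := he_D ex' (v := idm D' - c ∘ d).
    by rewrite composeBr composem1 composeA hc -e subrr.
  exists (d + g ∘ u); rewrite composeDr composeA cg -eu addrC.
  by rewrite subrK.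
have c_mono W (v : W ~> D) : c ∘ v = 0 -> v = 0.
  move=> cv0; have [|u eu] := he_D ex (v := v).
    by rewrite -hc -composeA cv0 compose0r.
  have [|t et] := he_B ex' (v := u).
    by rewrite -cg -composeA -eu.
  by rewrite eu et composeA (he_gf ex) compose0l.
have [d cd] := c_epi; exists d; split=> //.
apply/eqP; rewrite -subr_eq0; apply/eqP; apply: c_mono.
by rewrite composeBr composeA cd compose1m composem1 subrr.
Qed.

Lemma hom_exact_split (A D : C) (Z : biproduct A D) :
  hom_exact (in1 Z) (pr2 Z) 0.
Proof.
split=> [||W v v0|W v _|W v v0].
- exact: pr2_in1.
- exact: compose0r.
- exists (pr1 Z ∘ v); rewrite -[LHS]compose1m -(in_pr Z) composeDl.
  by rewrite -!composeA v0 compose0r addr0.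
- by exists (in2 Z ∘ v); rewrite composeA pr2_in2 compose1m.
- exists 0; rewrite compose0r -[LHS]compose1m -fmap1 -(pr1_in1 Z) fmapM.
  by rewrite -composeA v0 compose0r.
Qed.

Lemma hom_exact_sum (A B D A' B' D' : C)
    (f : A ~> B) (g : B ~> D) (h : D ~> S A)
    (f' : A' ~> B') (g' : B' ~> D') (h' : D' ~> S A')
    (SA : biproduct A A') (SB : biproduct B B') (SD : biproduct D D') :
  hom_exact f g h -> hom_exact f' g' h' ->
  hom_exact (dsum SA SB f f') (dsum SB SD g g')
    (dsum SD (fmap_biproduct S SA) h h' : SD ~> S SA).
Proof.
move=> ex ex'; split.
- by rewrite dsumM (he_gf ex) (he_gf ex') dsum0.
- rewrite fmap_dsum.
  apply: etrans (dsumM SD (fmap_biproduct S SA) (fmap_biproduct S SB) _ _ _ _) _.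
  by rewrite (he_fh ex) (he_fh ex') dsum0.
- by move=> W; apply: dsum_exact; [exact: (he_B ex)|exact: (he_B ex')].
- move=> W; apply: (@dsum_exact _ _ _ _ _ _ _ _ _ _ _ SB SD
    (fmap_biproduct S SA)); [exact: (he_D ex)|exact: (he_D ex')].
- move=> W; rewrite fmap_dsum.
  apply: (@dsum_exact _ _ _ _ _ _ _ _ _ _ _ SD (fmap_biproduct S SA)
    (fmap_biproduct S SB)); [exact: (he_SA ex)|exact: (he_SA ex')].
Qed.

Variable Delta : triangle_class S.
Hypothesis tri : triangulated Delta.

Lemma tr_rot (A B D : C) (f : A ~> B) (g : B ~> D) (h : D ~> S A) :
  Delta (Triangle f g h) -> Delta (Triangle g h (- fmap S f)).
Proof. exact: proj1 (tr_rotate tri f g h). Qed.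

Lemma tr_unrot (A B D : C) (f : A ~> B) (g : B ~> D) (h : D ~> S A) :
  Delta (Triangle g h (- fmap S f)) -> Delta (Triangle f g h).
Proof. exact: proj2 (tr_rotate tri f g h). Qed.

Lemma tr_zero_id (W Z : C) : is_zero Z ->
  Delta (Triangle (0 : Z ~> W) (idm W) (0 : W ~> S Z)).
Proof.
move=> Z0; apply: tr_unrot; rewrite fmap0 oppr0.
exact/(tr_id tri)/fmap_zero.
Qed.

Section OneTriangle.
Variables (A B D : C) (f : A ~> B) (g : B ~> D) (h : D ~> S A).
Hypothesis T : Delta (Triangle f g h).

Lemma tr_rotate2 : Delta (Triangle h (- fmap S f) (- fmap S g)).
Proof. exact: tr_rot (tr_rot T). Qed.

Lemma tr_comp0 : g ∘ f = 0.
Proof.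
have [Z Z0] := has_zero C.
have [|c /= [e _]] := tr_morphism tri (tr_id tri A Z0) T (a := idm A) (b := f).
  by [].
by rewrite -e compose0r.
Qed.

(** A map killed by [g] is a map from the rotated triangle of the identity of [W]
    to the rotated triangle [(g, h, - S f)]; the axiom completing it gives the
    lift, after suspension. *)
Lemma tr_weak_kernel W (v : W ~> B) : g ∘ v = 0 -> exists u, v = f ∘ u.
Proof.
move=> gv0; have [Z Z0] := has_zero C.
have T1 := tr_rot (tr_id tri W Z0).
have T2 := tr_rot T.
have [|c /= [_ e]] := tr_morphism tri T1 T2 (a := v) (b := 0).
  by rewrite /= compose0l gv0.
have [u eu] := susp_full c; exists u; apply: (@susp_faithful _ S).
move: e; rewrite fmap1 composeNr composem1 composeNl -eu -fmapM.
by move/oppr_inj.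
Qed.

Lemma tr_weak_cokernel W (v : B ~> W) : v ∘ f = 0 -> exists u, v = u ∘ g.
Proof.
move=> vf0; have [Z Z0] := has_zero C.
have [|c /= [e _]] := tr_morphism tri T (tr_zero_id W Z0) (a := 0) (b := v).
  by rewrite /= compose0l vf0.
by exists c; rewrite e compose1m.
Qed.

End OneTriangle.

Section OneTriangleRotated.
Variables (A B D : C) (f : A ~> B) (g : B ~> D) (h : D ~> S A).
Hypothesis T : Delta (Triangle f g h).

Let T1 : Delta (Triangle g h (- fmap S f)) := tr_rot T.
Let T2 : Delta (Triangle h (- fmap S f) (- fmap S g)) := tr_rotate2 T.

Lemma tr_hom_exact : hom_exact f g h.
Proof.
split.
- exact: tr_comp0 T.
- by have := tr_comp0 T2; rewrite composeNl => /eqP; rewrite oppr_eq0 => /eqP.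
- exact: tr_weak_kernel T.
- exact: tr_weak_kernel T1.
- move=> W v v0; apply: (tr_weak_kernel T2).
  by rewrite composeNl v0 oppr0.
Qed.

Lemma tr_weak_cokernel_h W (v : D ~> W) : v ∘ g = 0 -> exists u, v = u ∘ h.
Proof. exact: tr_weak_cokernel T1 _ _. Qed.

Lemma tr_weak_cokernel_Sf W (v : S A ~> W) :
  v ∘ h = 0 -> exists u, v = u ∘ fmap S f.
Proof.
move=> v0; have [u ->] := tr_weak_cokernel T2 v0.
by exists (- u); rewrite composeNl composeNr.
Qed.

Lemma tr_hg0 : h ∘ g = 0. Proof. exact: tr_comp0 T1. Qed.

End OneTriangleRotated.

(** Rotating a cone back requires its last object to be a suspension; replace
    it by the isomorphic object [S (loops S Z)]. *)
Lemma tr_fiber (B D : C) (g : B ~> D) :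
  exists (A : C) (f : A ~> B) (h : D ~> S A), Delta (Triangle f g h).
Proof.
have [Z [k [l T]]] := tr_cone tri g.
have [f ef] := susp_full (- (l ∘ eps S Z)).
exists (loops S Z), f, (epsV S Z ∘ k); apply: tr_unrot; rewrite ef opprK.
apply: tr_iso tri _ _ _ T; exists (idm B), (idm D), (epsV S Z); split.
  split; [exact: is_iso_idm|exact: is_iso_idm|].
  by exists (eps S Z); rewrite epsK epsVK.
split=> /=; first by rewrite compose1m composem1.
  by rewrite composem1.
by rewrite fmap1 compose1m -composeA epsVK composem1.
Qed.

Lemma tr_cocone (D A : C) (h : D ~> S A) :
  exists (B : C) (f : A ~> B) (g : B ~> D), Delta (Triangle f g h).
Proof.
have [B [g [w T]]] := tr_fiber h; have [f ef] := susp_full (- w).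
by exists B, f, g; apply: tr_unrot; rewrite ef opprK.
Qed.

(** Rotating twice turns a map of third terms and first terms into a map of
    first and second terms. *)
Lemma tr_fill_middle (A B D A' B' D' : C)
    (f : A ~> B) (g : B ~> D) (h : D ~> S A)
    (f' : A' ~> B') (g' : B' ~> D') (h' : D' ~> S A') (a : A ~> A') (c : D ~> D') :
  Delta (Triangle f g h) -> Delta (Triangle f' g' h') ->
  fmap S a ∘ h = h' ∘ c ->
  exists b : B ~> B', b ∘ f = f' ∘ a /\ g' ∘ b = c ∘ g.
Proof.
move=> T T' e.
have [c' /= []] := tr_morphism tri (tr_rotate2 T) (tr_rotate2 T')
  (a := c) (b := fmap S a) e.
have [b <-] := susp_full c'; rewrite !composeNr !composeNl -!fmapM.
move=> /oppr_inj/susp_faithful ef /oppr_inj/susp_faithful eg.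
by exists b.
Qed.

Lemma tr_fill_left (A B D A' B' D' : C)
    (f : A ~> B) (g : B ~> D) (h : D ~> S A)
    (f' : A' ~> B') (g' : B' ~> D') (h' : D' ~> S A') (b : B ~> B') (c : D ~> D') :
  Delta (Triangle f g h) -> Delta (Triangle f' g' h') -> c ∘ g = g' ∘ b ->
  exists a : A ~> A', b ∘ f = f' ∘ a /\ fmap S a ∘ h = h' ∘ c.
Proof.
move=> /tr_rot T /tr_rot T' e.
have [c' /= []] := tr_morphism tri T T' (a := b) (b := c) e.
have [a <-] := susp_full c'; rewrite !composeNr !composeNl -!fmapM => ea.
by move=> /oppr_inj/susp_faithful ef; exists a.
Qed.

(** The signs in [shift] are those of three rotations. *)
Lemma tr_shift (T : triangle S) : Delta T <-> Delta (shift T).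
Proof.
case: T => A B D f g h; split; first by move/tr_rot/tr_rot/tr_rot.
by move/tr_unrot/tr_unrot/tr_unrot.
Qed.

(** The octahedral axiom for a composite of second maps: the given one is applied
    to the rotated triangles, whose relevant terms are suspensions, and the maps
    it produces desuspend because the suspension is full and faithful. *)
Lemma tr_octahedral_op (A B D F G : C)
    (f' : D ~> A) (f : A ~> B) (x : B ~> S D)
    (g' : F ~> B) (g : B ~> G) (x' : G ~> S F) :
  Delta (Triangle f' f x) -> Delta (Triangle g' g x') ->
  exists (K : C) (h : K ~> A) (k : G ~> S K) (d : D ~> K) (e : K ~> F),
    [/\ Delta (Triangle h (g ∘ f) k) & Delta (Triangle d e (x ∘ g'))] /\
    [/\ h ∘ d = f', f ∘ h = g' ∘ e, fmap S d ∘ x = k ∘ g & fmap S e ∘ k = x'].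
Proof.
move=> T T'; have [K [h [k T'']]] := tr_fiber (g ∘ f).
have [sd [se []]] := tr_octahedral tri (tr_rot T) (tr_rot T') (tr_rot T'').
have [d <-] := susp_full sd; have [e <-] := susp_full se.
move=> Tde dx ek; rewrite !composeNr !composeNl -!fmapM.
move=> /oppr_inj/susp_faithful hd /oppr_inj/susp_faithful ge.
exists K, h, k, d, e; split; last by split.
(* The octahedron gives the shifted triangle up to the sign of the first two
   maps, which is absorbed by -1 on the middle term. *)
split=> //; apply/(tr_shift (Triangle d e _)).
apply: tr_iso tri _ _ _ Tde; exists (idm _), (- idm _), (idm _).
split; first by split; [|apply: is_iso_opp|]; exact: is_iso_idm.
split=> /=; first by rewrite composeNl compose1m composem1.
  by rewrite compose1m composeNr composeNl opprK composem1.
by rewrite fmap1 compose1m composem1 composeNr fmapM.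
Qed.

Lemma tr_iso_third (A B D D' : C) (f : A ~> B) (g : B ~> D) (h : D ~> S A)
    (g' : B ~> D') (h' : D' ~> S A) (c : D ~> D') :
  is_iso c -> c ∘ g = g' -> h' ∘ c = h ->
  Delta (Triangle f g' h') -> Delta (Triangle f g h).
Proof.
case=> d [dc cd] cg hc; apply: (tr_iso tri).
exists (idm A), (idm B), d; split.
  by split; [exact: is_iso_idm|exact: is_iso_idm|exists c].
split=> /=; first by rewrite compose1m composem1.
  by rewrite composem1 -cg composeA dc compose1m.
by rewrite fmap1 compose1m -hc -composeA cd composem1.
Qed.

(** To recognize a distinguished triangle, compare it with the cone of its first
    map. *)
Lemma tr_of_hom_exact (A B D D' : C) (f : A ~> B) (g : B ~> D) (h : D ~> S A)
    (g' : B ~> D') (h' : D' ~> S A) (c : D ~> D') :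
  hom_exact f g h -> Delta (Triangle f g' h') -> c ∘ g = g' -> h' ∘ c = h ->
  Delta (Triangle f g h).
Proof.
move=> ex T cg hc; apply: (tr_iso_third _ cg hc T).
exact: hom_exact_iso ex (tr_hom_exact T) cg hc.
Qed.

Lemma tr_split (A D : C) (Z : biproduct A D) :
  Delta (Triangle (in1 Z) (pr2 Z) (0 : D ~> S A)).
Proof.
have [E [g [h T]]] := tr_cone tri (in1 Z).
apply: (tr_of_hom_exact (c := g ∘ in2 Z) (hom_exact_split Z) T).
  rewrite -composeA; apply/esym; rewrite -[LHS]composem1 -(in_pr Z) composeDr.
  by rewrite !composeA (tr_comp0 T) compose0l add0r.
by rewrite composeA (tr_hg0 T) compose0l.
Qed.

(** A sum of distinguished triangles is compared with the cone of the sum of the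
    first maps; both are exact under Hom, so the five lemma applies. *)
Lemma tr_sum (A B D A' B' D' : C)
    (f : A ~> B) (g : B ~> D) (h : D ~> S A)
    (f' : A' ~> B') (g' : B' ~> D') (h' : D' ~> S A')
    (SA : biproduct A A') (SB : biproduct B B') (SD : biproduct D D') :
  Delta (Triangle f g h) -> Delta (Triangle f' g' h') ->
  Delta (Triangle (dsum SA SB f f') (dsum SB SD g g')
    (dsum SD (fmap_biproduct S SA) h h' : SD ~> S SA)).
Proof.
move=> T T'; have [E [k [l TE]]] := tr_cone tri (dsum SA SB f f').
have [|c /= [ec lc]] := tr_morphism tri T TE (a := in1 SA) (b := in1 SB).
  by rewrite /= dsum_in1.
have [|c' /= [ec' lc']] := tr_morphism tri T' TE (a := in2 SA) (b := in2 SB).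
  by rewrite /= dsum_in2.
apply: (tr_of_hom_exact (c := c ∘ pr1 SD + c' ∘ pr2 SD) _ TE).
- exact: hom_exact_sum (tr_hom_exact T) (tr_hom_exact T').
- rewrite composeDl -!composeA pr1_dsum pr2_dsum !composeA ec ec' -!composeA.
  by rewrite -composeDr in_pr composem1.
- by rewrite composeDr !composeA -lc -lc'.
Qed.

(** The sequences that complete a given third map therefore form a single
    equivalence class, which is what a realization requires. *)
Lemma tr_middle_unique (A B B' D : C) (f : A ~> B) (g : B ~> D)
    (f' : A ~> B') (g' : B' ~> D) (h : D ~> S A) :
  Delta (Triangle f g h) -> Delta (Triangle f' g' h) ->
  exists b : B ~> B', [/\ is_iso b, b ∘ f = f' & g' ∘ b = g].
Proof.
move=> T T'.
have [|b [bf gb]] := tr_fill_middle (a := idm A) (c := idm D) T T'.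
  by rewrite fmap1 compose1m composem1.
rewrite composem1 in bf; rewrite compose1m in gb.
exists b; split=> //; apply: (@susp_reflects_iso _ S).
apply: hom_exact_iso (tr_hom_exact (tr_rotate2 T)) (tr_hom_exact (tr_rotate2 T')) _ _.
  by rewrite composeNr -fmapM bf.
by rewrite composeNl -fmapM gb.
Qed.

(** By the uniqueness of the middle term, a triangle with zero third map is
    isomorphic to the triangle of a biproduct. *)
Lemma tr_splitting (A B D : C) (f : A ~> B) (g : B ~> D) :
  Delta (Triangle f g (0 : D ~> S A)) <-> exists r s, splitting f g r s.
Proof.
split=> [T|[r [s H]]]; last exact: tr_split (splitting_biproduct H).
have [Z] := has_biproducts A D.
have [b [[b' [b'b bb']] bf gb]] := tr_middle_unique (tr_split Z) T.
exists (pr1 Z ∘ b'), (b ∘ in2 Z); split.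
- by rewrite -bf -composeA (composeA b') b'b compose1m pr1_in1.
- by rewrite composeA gb pr2_in2.
- rewrite -bf -[g]composem1 -bb' (composeA g) gb -!composeA.
  by rewrite -composeDr !composeA -composeDl in_pr compose1m.
Qed.

(** The counit is the isomorphism. On third maps the factor [epsV] of [unshift]
    cancels against it, and the suspension of the factor [etaV] is again the
    counit, by the triangle identity. This reduces desuspending a triangle of
    the class to suspending one. *)
Lemma shift_unshift_iso (T : triangle S) : triangle_iso (shift (unshift T)) T.
Proof.
case: T => A B D f g h; exists (eps S A), (eps S B), (eps S D).
split; first by split; exact: eps_iso.
split=> /=.
- by rewrite fmapN opprK eps_nat.
- by rewrite fmapN opprK eps_nat.
- rewrite fmapN opprK !fmapM !composeA -fmapM epsVK fmap1 compose1m.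
  by rewrite fmap_etaV -eps_nat.
Qed.

Lemma triangle_iso_sym (T T' : triangle S) : triangle_iso T T' -> triangle_iso T' T.
Proof.
have flip A B A' B' (f : A ~> B) (f' : A' ~> B') (a : A ~> A') (b : B ~> B')
    (a' : A' ~> A) (b' : B' ~> B) : b ∘ f = f' ∘ a -> a ∘ a' = idm A' ->
    b' ∘ b = idm B -> b' ∘ f' = f ∘ a'.
  move=> e ea eb; rewrite -[f']composem1 -ea composeA composeA -(composeA b').
  by rewrite -e composeA eb compose1m.
case=> a [b] [c] [[[a' [a'a aa']] [b' [b'b bb']] [c' [c'c cc']]] [e1 e2 e3]].
exists a', b', c'; split; first by split; [exists a|exists b|exists c].
split; [exact: flip e1 aa' b'b|exact: flip e2 bb' c'c|].
by apply: flip e3 cc' _; rewrite -fmapM a'a fmap1.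
Qed.

End TriangulatedTheory.

(** * Ghosts and the relative structure *)

Section Ghosts.
Variables (C : additive_category) (S : autoequivalence C).
Variable Delta : triangle_class S.
Hypothesis tri : triangulated Delta.

Definition ghost (X : subcategory C) (D B : C) (x : D ~> B) : Prop :=
  forall P, X P -> forall v : P ~> D, x ∘ v = 0.

Definition coghost (Y : subcategory C) (D A : C) (x : D ~> S A) : Prop :=
  forall I, Y I -> forall u : A ~> I, fmap S u ∘ x = 0.

(** The surjectivity half of membership says exactly that the third map is a
    ghost; Sigma-stability turns it into the injectivity half, because a map
    killed by the first map of the triangle factors, after suspension, through
    the third one. *)
Lemma xi_projE (X : subcategory C) (T : triangle S) : sigma_stable S X ->
  xi_proj Delta X T <-> Delta T /\ ghost X (th T).
Proof.
case: T => A B D f g h [SX _]; split=> -[T H]; split=> //= P XP.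
  move=> v; have [_ /(_ v) [u <-]] := H P XP.
  by rewrite /= composeA (tr_hg0 tri T) compose0l.
have ex := tr_hom_exact tri T; split=> [u v /= e|v].
  apply/eqP; rewrite -subr_eq0; apply/eqP; apply: (@susp_faithful _ S).
  have [|w ->] := he_SA ex (v := fmap S (u - v)).
    by rewrite -fmapM composeBr e subrr fmap0.
  by rewrite (H _ (SX _ XP)) fmap0.
by have [u ->] := he_D ex (H P XP v); exists u.
Qed.

(** Dual to [xi_projE], except that a desuspension of an object of [Y] is used
    for injectivity: maps out of the third map's target [S A] are compared with
    suspensions of maps out of [A]. *)
Lemma xi_injE (Y : subcategory C) (T : triangle S) : sigma_stable S Y ->
  xi_inj Delta Y T <-> Delta T /\ coghost Y (th T).
Proof.
case: T => A B D f g h [_ SY]; split=> -[T H]; split=> //= I YI.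
  move=> u; have [_ /(_ u) [v <-]] := H I YI.
  by rewrite /= fmapM -composeA (he_fh (tr_hom_exact tri T)) compose0r.
split=> [u v /= e|u].
  apply/eqP; rewrite -subr_eq0; apply/eqP.
  have [|w ->] := tr_weak_cokernel_h tri T (v := u - v).
    by rewrite composeBl e subrr.
  have [J YJ [i [j [ji _]]]] := SY _ YI; have [t et] := susp_full (i ∘ w).
  have := H J YJ t; rewrite et -composeA => e0.
  by rewrite -[w ∘ h]compose1m -ji -composeA e0 compose0r.
have [w e] := tr_weak_cokernel_Sf tri T (H I YI u).
have [v ev] := susp_full w; exists v; apply: (@susp_faithful _ S).
by rewrite /= fmapM ev.
Qed.

Lemma ghost_compr (X : subcategory C) (D B E : C) (x : D ~> B) (c : E ~> D) :
  ghost X x -> ghost X (x ∘ c).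
Proof. by move=> gx P XP v; rewrite -composeA gx. Qed.

Lemma ghost_compl (X : subcategory C) (D B E : C) (x : D ~> B) (a : B ~> E) :
  ghost X x -> ghost X (a ∘ x).
Proof. by move=> gx P XP v; rewrite -composeA gx // compose0r. Qed.

Lemma ghost0 (X : subcategory C) (D B : C) : ghost X (0 : D ~> B).
Proof. by move=> P _ v; rewrite compose0l. Qed.

Lemma ghostB (X : subcategory C) (D B : C) (x y : D ~> B) :
  ghost X x -> ghost X y -> ghost X (x - y).
Proof. by move=> gx gy P XP v; rewrite composeBl gx // gy // subrr. Qed.

Lemma ghost_dsum (X : subcategory C) (D B D' B' : C) (x : D ~> B) (x' : D' ~> B')
    (SD : biproduct D D') (SB : biproduct B B') :
  ghost X x -> ghost X x' -> ghost X (dsum SD SB x x').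
Proof.
move=> gx gx' P XP v; rewrite composeDl -!composeA gx // gx' //.
by rewrite !compose0r addr0.
Qed.

Lemma ghost_susp (X : subcategory C) (D B : C) (x : D ~> B) :
  sigma_stable S X -> ghost X (fmap S x) <-> ghost X x.
Proof.
move=> [SX XS]; split=> gx P XP v.
  by apply: (@susp_faithful _ S); rewrite fmapM fmap0 gx //; apply: SX.
have [Q XQ [i [j [ji _]]]] := XS _ XP; have [w ew] := susp_full (v ∘ j).
rewrite -[v]composem1 -ji (composeA v j i) -ew composeA -fmapM.
by rewrite gx // fmap0 compose0l.
Qed.

(** When every object admits an [X]-approximation whose triangle is also
    [Y]-exact, and dually, ghosts and coghosts agree: a ghost on [D] vanishes on
    the approximation of [D], so it factors through the third map of its
    triangle, which is a coghost. *)
Lemma ghost_coghost (X Y : subcategory C) (D A : C) (x : D ~> S A) :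
  (exists (K P : C) (f : K ~> P) (g : P ~> D) (h : D ~> S K),
    [/\ Delta (Triangle f g h), X P & coghost Y h]) ->
  ghost X x -> coghost Y x.
Proof.
move=> [K [P [f [g [h [T XP cgh]]]]]] gx I YI u.
have [w ->] := tr_weak_cokernel_h tri T (gx P XP g).
have [t <-] := susp_full w.
by rewrite composeA -fmapM cgh.
Qed.

(** Dually, a coghost with values in [S A] becomes zero in the suspension of the
    [Y]-approximation of [A], so it factors through a ghost. *)
Lemma coghost_ghost (X Y : subcategory C) (D A : C) (x : D ~> S A) :
  (exists (I K : C) (f : A ~> I) (g : I ~> K) (h : K ~> S A),
    [/\ Delta (Triangle f g h), Y I & ghost X h]) ->
  coghost Y x -> ghost X x.
Proof.
move=> [I [K [f [g [h [T YI gh]]]]]] cgx P XP v.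
have [w ->] := he_SA (tr_hom_exact tri T) (cgx I YI f).
by rewrite -composeA gh.
Qed.

Section OneSide.
Variable X : subcategory C.
Hypothesis SX : sigma_stable S X.

Let xi := xi_proj Delta X.

(** The third maps of base and cobase changes are composites with the original
    third map, and for saturation a test map [v : P ~> D] lifts along the second
    column before the third map of the first row is applied. *)
Lemma xi_proj_proper : proper_class Delta xi.
Proof.
have E T := xi_projE T SX.
have iso T T' : triangle_iso T T' -> xi T -> xi T'.
  move=> i /E [DT gT]; apply/E; split; first exact: tr_iso tri _ _ i DT.
  case: i => a [b] [c] [[_ _ [c' [_ cc']]] [_ _ e]] P XP v.
  rewrite -[v]compose1m -cc' -composeA composeA -e -composeA gT //.
  by rewrite compose0r.
have shiftE T : xi T <-> xi (shift T).
  split=> /E [DT gT]; apply/E; split.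
  - exact: proj1 (tr_shift tri T) DT.
  - by move=> P XP v; rewrite composeNl (proj2 (ghost_susp _ SX) gT) ?oppr0.
  - exact: proj2 (tr_shift tri T) DT.
  - apply/(ghost_susp _ SX) => P XP v; apply: oppr_inj.
    by rewrite oppr0 -composeNl; apply: gT.
have unshift_xi T : xi T -> xi (unshift T).
  move=> xT; apply/shiftE; apply: iso xT.
  exact/triangle_iso_sym/shift_unshift_iso.
split=> //.
- by move=> T [].
- by move=> T [DT h0]; apply/E; split=> //; rewrite h0; apply: ghost0.
- move=> [A B D f g h] [A' B' D' f' g' h'] SA SB SD /E [DT gT] /E [DT' gT'].
  by apply/E; split; [exact: tr_sum|
     exact: (@ghost_dsum X D (S A) D' (S A') h h' SD (fmap_biproduct S SA))].
- case=> n T xT; first by elim: n => //= n; apply: (proj1 (shiftE _)).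
  have xn m : xi (iter m (@unshift C S) T).
    by elim: m => //= m; apply: (unshift_xi _).
  exact: xn n.+1.
- move=> A B D E' G M f g h f' g' h' al be ga de ep ze bc.
  move=> /E [T1 g1] /E [_ g2]; apply/E; split; first exact: bc_row2 bc.
  move=> P XP v; have [w ->] := he_D (tr_hom_exact tri T1) (g1 P XP v).
  by rewrite composeA /= -(bc_hE bc); apply: g2.
- move=> A B D E' G M f g h f' g' h' al be ga de ep ze bc.
  move=> /E [_ gh]; apply/E; split; first exact: bc_row1 bc.
  by rewrite /= (bc_hE bc); apply: ghost_compr.
- move=> A B D E' F f g h al f' g' /E [_ gh] T; apply/E; split=> //.
  exact: ghost_compl.
Qed.

Lemma triangle_realizationE (D A : C) (x : hom_bifunctor S D A) (q : sequence A D) :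
  triangle_realization Delta x q <-> Delta (@Triangle _ S _ _ _ (sx q) (sy q) x).
Proof.
split=> [[q0 T [b [ib bx yb]]]|T]; last first.
  by exists q => //; exists (idm _); rewrite compose1m composem1; split=> //;
    exact: is_iso_idm.
apply: tr_iso tri _ _ _ T; exists (idm A), b, (idm D).
split; first by split=> //; exact: is_iso_idm.
split=> /=; first by rewrite composem1.
  by rewrite compose1m.
by rewrite fmap1 compose1m composem1.
Qed.

Lemma in_E_xiE (D A : C) (x : hom_bifunctor S D A) :
  in_E_xi Delta xi x <-> ghost X (x : D ~> S A).
Proof.
split=> [[q _ /(xi_projE _ SX) [_]] //|gx].
have [B [f [g T]]] := tr_cocone tri x.
exists (Sequence f g); first exact/triangle_realizationE.
exact/(xi_projE _ SX).
Qed.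

Lemma ghost_subbifunctor : subbifunctor_closed (in_E_xi Delta xi).
Proof.
split=> [D A|D A A' a x|D' D A c x].
- split; first exact/in_E_xiE/ghost0.
  by move=> x y /in_E_xiE gx /in_E_xiE gy; apply/in_E_xiE/ghostB.
- by move=> /in_E_xiE gx; apply/in_E_xiE/ghost_compl.
- by move=> /in_E_xiE gx; apply/in_E_xiE/ghost_compr.
Qed.

Variable HE : subbifunctor_closed (in_E_xi Delta xi).

Definition ghost_ext (D A : C) (x : D ~> S A) (gx : ghost X x) : E_xi HE D A :=
  subgroup_elt _ (proj2 (@in_E_xiE D A x) gx).

Lemma ghost_val (D A : C) (x : E_xi HE D A) : ghost X (val x : D ~> S A).
Proof. exact: proj1 (in_E_xiE _) (subgroupP x). Qed.

Lemma s_xiE (D A : C) (x : E_xi HE D A) (q : sequence A D) :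
  s_xi HE D A x q <-> Delta (@Triangle _ S _ _ _ (sx q) (sy q) (val x)).
Proof. exact: triangle_realizationE. Qed.

Lemma s_xi_additive : additive_realization (s_xi HE).
Proof.
split; first split.
- move=> D A x; have [B [f [g T]]] := tr_cocone tri (val x).
  exists (Sequence f g) => q; split=> [/s_xiE T'|e]; last by exists (Sequence f g).
  exact: tr_middle_unique T T'.
- move=> D A D' A' x x' q q' /s_xiE T /s_xiE T' a c e.
  apply: (tr_fill_middle tri T T').
  exact: (congr1 val e).
- by move=> D A Z; apply/s_xiE; apply: tr_split.
- move=> D A D' A' x x' q q' SA SB SD /s_xiE T /s_xiE T'; apply/s_xiE.
  have e : val (ext_sum x x' SA SD) =
      dsum SD (fmap_biproduct S SA) (val x : D ~> S A) (val x' : D' ~> S A').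
    by rewrite /dsum -!composeA.
  by rewrite e; have H := tr_sum tri SA SB SD T T'.
Qed.

(** The lifts and fillings of (ET3) and its dual exist already in the
    triangulated category and involve no new extension. For (ET4) and its
    dual the new extension is a ghost: on a test object [P] it factors through
    one of the two given extensions once the other one is known to vanish. *)
Lemma s_xi_extriangulated : extriangulated (s_xi HE).
Proof.
split; first exact: s_xi_additive.
- move=> D A D' A' x x' q q' /s_xiE T /s_xiE T' a b e.
  have [c [ec ea]] := tr_morphism tri T T' e.
  by exists c; split=> //; apply: val_inj.
- move=> D A D' A' x x' q q' /s_xiE T /s_xiE T' b c e.
  have [a [eb ea]] := tr_fill_left tri T T' e.
  by exists a; split=> //; apply: val_inj.
- move=> A B D F G x x' f f' g g' /s_xiE /= T /s_xiE /= T'.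
  have [K [h' [h'' T'']]] := tr_cone tri (g ∘ f).
  have [d [e [Te ed eh hd xe]]] := tr_octahedral tri T T' T''.
  have gh : ghost X h''.
    move=> P XP v.
    have [|u ->] := he_SA (tr_hom_exact tri T) (v := h'' ∘ v).
      by rewrite composeA -xe; apply: (ghost_compr _ (@ghost_val _ _ x')).
    exact: ghost_val.
  exists K, h', d, e, (ghost_ext gh); split=> //; split.
  + exact/s_xiE.
  + exact/s_xiE.
  + exact: val_inj.
  + by apply: val_inj; rewrite /= -xe.
- move=> A B D F G x x' f' f g' g /s_xiE /= T /s_xiE /= T'.
  have [K [h [k [d [e [[Tk Td] [hd fh dx ek]]]]]]] := tr_octahedral_op tri T T'.
  have gk : ghost X k.
    move=> P XP v.
    have [|w ->] := he_D (tr_hom_exact tri T') (v := v).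
      exact: (ghost_val x').
    by rewrite composeA -dx -composeA (ghost_val x) // compose0r.
  exists K, h, d, e, (ghost_ext gk); split=> //; split.
  + exact/s_xiE.
  + exact/s_xiE.
  + by apply: val_inj; rewrite /= ek.
  + by apply: val_inj; rewrite /= dx.
Qed.

End OneSide.
End Ghosts.

(** * Exact structure of split sequences *)

(** If every ghost is zero then all conflations split, and the biproduct
    decompositions give the exact structure. *)
Section AllGhostsZero.
Variables (C : additive_category) (S : autoequivalence C).
Variable Delta : triangle_class S.
Hypothesis tri : triangulated Delta.
Variable X : subcategory C.
Hypothesis SX : sigma_stable S X.
Variable HE : subbifunctor_closed (in_E_xi Delta (xi_proj Delta X)).
Hypothesis ghosts0 : forall (D A : C) (x : D ~> S A), ghost X x -> x = 0.

Let K := conflation (s_xi HE).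

Lemma E_xi_trivial (D A : C) (x y : E_xi HE D A) : x = y.
Proof.
apply: val_inj; rewrite [LHS](ghosts0 (ghost_val tri SX x)).
by rewrite [RHS](ghosts0 (ghost_val tri SX y)).
Qed.

Lemma conflation_splitting (A D : C) (q : sequence A D) :
  K q <-> exists r s, splitting (sx q) (sy q) r s.
Proof.
rewrite -(tr_splitting tri); split=> [[x /(s_xiE tri)]|T].
  by rewrite (ghosts0 (ghost_val tri SX x)).
by exists 0; apply/(s_xiE tri).
Qed.

(** The cone of a split monomorphism has zero third map, since the suspension of
    the monomorphism kills it and is left cancellable. *)
Lemma admissible_monoE (A B : C) (x : A ~> B) :
  admissible_mono K x <-> exists r, r ∘ x = idm A.
Proof.
split=> [[D [y /conflation_splitting [r [s []]]]]|[r rx]]; first by exists r.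
have [D [y [h T]]] := tr_cone tri x; exists D, y; apply/conflation_splitting.
apply/(tr_splitting tri); rewrite -(_ : h = 0) //.
rewrite -[h]compose1m -fmap1 -rx fmapM -composeA.
by rewrite (he_fh (tr_hom_exact tri T)) compose0r.
Qed.

Lemma admissible_epiE (B D : C) (y : B ~> D) :
  admissible_epi K y <-> exists s, y ∘ s = idm D.
Proof.
split=> [[A [x /conflation_splitting [r [s []]]]]|[s ys]]; first by exists s.
have [A [x [h T]]] := tr_fiber tri y; exists A, x; apply/conflation_splitting.
apply/(tr_splitting tri); rewrite -(_ : h = 0) //.
by rewrite -[h]composem1 -ys composeA (tr_hg0 tri T) compose0l.
Qed.

Lemma split_exact_structure : exact_structure K.
Proof.
split.
- move=> A D q /conflation_splitting [r [s H]].
  by split; [exact: splitting_kernel H|exact: splitting_cokernel H].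
- move=> A D A' D' q q' a b c ia ib ic ba cb.
  move=> /conflation_splitting/(tr_splitting tri) T.
  apply/conflation_splitting/(tr_splitting tri); apply: tr_iso tri _ _ _ T.
  exists a, b, c; do 2!split=> //=.
  by rewrite compose0r compose0l.
- by move=> A; apply/admissible_monoE; exists (idm A); rewrite compose1m.
- by move=> A; apply/admissible_epiE; exists (idm A); rewrite compose1m.
- move=> A B D f g /admissible_monoE [r rf] /admissible_monoE [t tg].
  apply/admissible_monoE; exists (r ∘ t).
  by rewrite -composeA (composeA t g) tg compose1m.
- move=> A B D f g /admissible_epiE [r fr] /admissible_epiE [t gt].
  apply/admissible_epiE; exists (r ∘ t).
  by rewrite -composeA (composeA f r) fr compose1m.
- move=> A B A' x a [D [y /conflation_splitting [r [s H]]]].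
  have [Z] := has_biproducts A' D; have [rx _ _] := H; have yx := splitting_yx H.
  exists Z, (in1 Z), (in1 Z ∘ a ∘ r + in2 Z ∘ y); split.
    apply: splitting_pushout H (biproduct_splitting Z) _ _.
      rewrite composeDl -!composeA yx rx.
      by rewrite compose0r addr0 composem1.
    by rewrite composeDr !composeA pr2_in1 pr2_in2 !compose0l add0r compose1m.
  by apply/admissible_monoE; exists (pr1 Z); apply: pr1_in1.
- move=> B D D' y c [A [x /conflation_splitting [r [s H]]]].
  have [Z] := has_biproducts A D'; have [_ ys _] := H; have yx := splitting_yx H.
  exists Z, (pr2 Z), (x ∘ pr1 Z + s ∘ c ∘ pr2 Z); split.
    apply: splitting_pullback H (biproduct_splitting Z) _ _.
      by rewrite composeDl -!composeA pr1_in1 pr2_in1 !compose0r addr0 composem1.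
    rewrite composeDr !composeA yx ys.
    by rewrite !compose0l add0r compose1m.
  by apply/admissible_epiE; exists (in2 Z); apply: pr2_in2.
Qed.

(** The extension groups vanish, so the Yoneda operations only have to send split
    sequences to split ones; the maps of sequences given by the realization are
    the required pushout and pullback squares. *)
Lemma split_is_exact_category : is_exact_category (s_xi HE).
Proof.
have rz := s_xi_additive tri HE.
have pushP D A A' (a : A ~> A') (x : E_xi HE D A) q q' :
    s_xi HE _ _ x q -> s_xi HE _ _ (push _ a x) q' -> yoneda_push K a q q'.
  move=> xq xq'; split; first by exists (push _ a x).
  have [|b [bx yb]] := rz_morphism rz xq xq' (a := a) (c := idm D).
    by rewrite pull1.
  rewrite compose1m in yb; exists b; split=> //.
  have /conflation_splitting [r [s H]] : K q by exists x.
  have /conflation_splitting [r' [s' H']] : K q' by exists (push _ a x).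
  exact: splitting_pushout H H' bx yb.
have pullP D' D A (c : D' ~> D) (x : E_xi HE D A) q q' :
    s_xi HE _ _ x q -> s_xi HE _ _ (pull _ c x) q' -> yoneda_pull K c q q'.
  move=> xq xq'; split; first by exists (pull _ c x).
  have [|b [bx yb]] := rz_morphism rz xq' xq (a := idm A) (c := c).
    by rewrite push1.
  rewrite composem1 in bx; exists b; split=> //.
  have /conflation_splitting [r [s H]] : K q by exists x.
  have /conflation_splitting [r' [s' H']] : K q' by exists (pull _ c x).
  exact: splitting_pullback H H' bx yb.
split=> //.
- exact: split_exact_structure.
- exact: rz_class rz.
- by move=> D A x y q _ _; apply: E_xi_trivial.
- move=> D A x y q1 q2 q3 xq1 yq2 xyq3.
  have [SA] := has_biproducts A A; have [SD] := has_biproducts D D.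
  have [SB] := has_biproducts (mid q1) (mid q2).
  have sum := ar_sum rz SA SB SD xq1 yq2.
  have [q qP] := rz_class rz (pull _ (in1 SD + in2 SD) (ext_sum x y SA SD)).
  have qq : s_xi HE _ _ (pull _ (in1 SD + in2 SD) (ext_sum x y SA SD)) q.
    by apply/qP; exists (idm _); rewrite compose1m composem1; split=> //;
      exact: is_iso_idm.
  exists SA, SB, SD, q; split; first exact: pullP sum qq.
  by apply: pushP qq _; rewrite [push _ _ _](E_xi_trivial _ (x + y)).
Qed.

End AllGhostsZero.

(** * Balanced pairs *)

Section Balanced.
Variables (C : additive_category) (S : autoequivalence C).
Variable Delta : triangle_class S.
Hypothesis tri : triangulated Delta.
Variables X Y : subcategory C.
Hypothesis bal : balanced_pair Delta X Y.

Let SX : sigma_stable S X := bp_stableX bal.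
Let SY : sigma_stable S Y := bp_stableY bal.

(** Where the two forms of balance meet: the triangle is an approximation by a
    projective in the first one, and the start of a resolution in the second
    one. Everything after this lemma and its dual treats both at once. *)
Lemma balanced_left (M : C) :
  exists (K P : C) (f : K ~> P) (g : P ~> M) (h : M ~> S K),
    [/\ Delta (Triangle f g h), X P, ghost X h & coghost Y h].
Proof.
have start (K P : C) (f : K ~> P) (g : P ~> M) (h : M ~> S K) : X P ->
    xi_proj Delta X (Triangle f g h) -> xi_inj Delta Y (Triangle f g h) ->
    exists (K P : C) (f : K ~> P) (g : P ~> M) (h : M ~> S K),
      [/\ Delta (Triangle f g h), X P, ghost X h & coghost Y h].
  by move=> XP /(xi_projE tri _ SX) [T gh] /(xi_injE tri _ SY) [_ cgh];
    exists K, P, f, g, h.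
case: (bp_cond bal) => [[xiE XE _ enP _]|[_ _ res _]].
  have [K [P [f [g [h [T /XE XP]]]]]] := enP M.
  exact: start XP T (proj1 (xiE _) T).
have [Z [d [XZ [K [g [f [h H]]]]]]] := res M.
have [[T T'] _] := H 0%N.
exact: start (XZ 0%N) T T'.
Qed.

Lemma balanced_right (M : C) :
  exists (I K : C) (f : M ~> I) (g : I ~> K) (h : K ~> S M),
    [/\ Delta (Triangle f g h), Y I, ghost X h & coghost Y h].
Proof.
have start (I K : C) (f : M ~> I) (g : I ~> K) (h : K ~> S M) : Y I ->
    xi_inj Delta Y (Triangle f g h) -> xi_proj Delta X (Triangle f g h) ->
    exists (I K : C) (f : M ~> I) (g : I ~> K) (h : K ~> S M),
      [/\ Delta (Triangle f g h), Y I, ghost X h & coghost Y h].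
  by move=> YI /(xi_injE tri _ SY) [T cgh] /(xi_projE tri _ SX) [_ gh];
    exists I, K, f, g, h.
case: (bp_cond bal) => [[xiE _ YE _ enI]|[_ _ _ res]].
  have [I [K [f [g [h [T /YE YI]]]]]] := enI M.
  exact: start YI T (proj2 (xiE _) T).
have [Z [d [YZ [K [g [f [h H]]]]]]] := res M.
have [[T T'] _] := H 0%N.
exact: start (YZ 0%N) T T'.
Qed.

Lemma balanced_xiE (T : triangle S) : xi_proj Delta X T <-> xi_inj Delta Y T.
Proof.
rewrite (xi_projE tri _ SX) (xi_injE tri _ SY); split=> -[DT H]; split=> //.
  apply: (ghost_coghost tri) H.
  by have [K [P [f [g [h []]]]]] := balanced_left (tC T); exists K, P, f, g, h.
apply: (coghost_ghost tri) H.
by have [I [K [f [g [h []]]]]] := balanced_right (tA T); exists I, K, f, g, h.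
Qed.

(** A zero object is a biproduct of any two zero objects, so closure under
    summands yields all of them once there is one. *)
Lemma summand_closed_zero (W : subcategory C) (A : C) :
  additive_subcategory W -> summand_closed W -> is_zero A -> W A.
Proof.
move=> [[Z Z0 WZ] _] sW A0.
have eq0 B (u v : Z ~> B) : u = v by rewrite (proj1 (Z0 B) u) (proj1 (Z0 B) v).
have eqA0 B (u v : A ~> B) : u = v by rewrite (proj1 (A0 B) u) (proj1 (A0 B) v).
pose ZB := @Biproduct C A A Z 0 0 0 0 (eqA0 _ _ _) (eqA0 _ _ _) (eqA0 _ _ _)
  (eqA0 _ _ _) (eq0 _ _ _).
by case: (sW _ _ ZB WZ).
Qed.

Lemma summand_closed_splitting (W : subcategory C) (A B D : C)
    (f : A ~> B) (g : B ~> D) : summand_closed W ->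
  Delta (Triangle f g (0 : D ~> S A)) -> W B -> W A /\ W D.
Proof.
move=> sW /(tr_splitting tri) [r [s H]] WB.
exact: sW _ _ (splitting_biproduct H) WB.
Qed.

Variable HE : subbifunctor_closed (in_E_xi Delta (xi_proj Delta X)).

(** In a triangulated category [A -> 0 -> S' A] is a conflation for every [A], so
    there is a triangle of the proper class with middle term zero starting at
    [A]; its exactness under [Hom(P, -)] and [Hom(-, I)] forces all maps
    [P -> A] and [A -> I] to vanish. *)
Lemma balanced_triangulated : is_triangulated_category (s_xi HE) ->
  (forall A, X A <-> is_zero A) /\ (forall A, Y A <-> is_zero A).
Proof.
case=> S' [Delta' [phi [tri' phi_bij _ _ sE]]].
have [Z Z0] := has_zero C.
have conf A : exists h : S' A ~> S A,
    xi_proj Delta X (Triangle (0 : A ~> Z) (0 : Z ~> S' A) h).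
  have T := tr_rot tri' (tr_id tri' A Z0).
  have [psi _ psiK] := phi_bij (S' A) A.
  rewrite -[- _]psiK in T.
  have /(s_xiE tri) T' := proj2 (sE _ _ _ (Sequence (0 : A ~> Z) 0)) T.
  exists (val (psi (- fmap S' (idm A)))).
  apply/(xi_projE tri _ SX); split=> //.
  exact: ghost_val.
split=> A; split; last first.
- exact: summand_closed_zero (bp_addY bal) (bp_summandY bal).
- move=> YA; apply: zero_of_idm.
  have [h /balanced_xiE [_ H]] := conf A.
  have [_ /(_ (idm A)) [v <-]] := H A YA.
  by rewrite /= compose0r.
- exact: summand_closed_zero (bp_addX bal) (bp_summandX bal).
- move=> XA; apply: zero_of_idm.
  have [h [_ H]] := conf A.
  have [inj _] := H A XA.
  by apply: inj; rewrite /= !compose0l.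
Qed.

(** When [X] consists of zero objects all maps are ghosts, so [E_xi] is all of
    [Hom(-, S -)] and the original triangles serve. *)
Lemma zero_triangulated : (forall A, X A -> is_zero A) ->
  is_triangulated_category (s_xi HE).
Proof.
move=> X0.
have gh (D A : C) (x : D ~> S A) : ghost X x.
  by move=> P /X0 P0 v; apply: (proj1 (P0 _)).
exists S, Delta, (fun D A (x : E_xi HE D A) => val x); split=> //.
- move=> D A; exists (fun x => ghost_ext tri SX HE (gh _ _ x)) => x //.
  exact: val_inj.
- by move=> D A x q; apply: (s_xiE tri).
Qed.

(** In an exact category the deflation of a triangle [(f, g, h)] is an
    epimorphism, so [h ∘ g = 0] gives [h = 0]: every ghost vanishes. In
    particular approximation triangles split. *)
Lemma balanced_exact : is_exact_category (s_xi HE) ->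
  (forall A, X A) /\ (forall A, Y A).
Proof.
move=> ex.
have ghosts0 (A B D : C) (f : A ~> B) (g : B ~> D) (h : D ~> S A) :
    Delta (Triangle f g h) -> ghost X h -> h = 0.
  move=> T gh; pose x := ghost_ext tri SX HE gh.
  have /(ex_kernel (iec_exact ex)) [_ [_ /= coker]] :
    conflation (s_xi HE) (Sequence f g) by exists x; apply/(s_xiE tri).
  (* Both [h] and 0 factor the zero map of [B] through the cokernel [g]. *)
  have [|v [_ uniq]] := coker _ (0 : B ~> S A); first exact: compose0l.
  by rewrite -(uniq h (tr_hg0 tri T)) -(uniq 0 (compose0l _ _)).
split=> A.
  have [K [P [f [g [h [T XP gh _]]]]]] := balanced_left A.
  have h0 := ghosts0 _ _ _ _ _ _ T gh; rewrite h0 in T.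
  by case: (summand_closed_splitting (bp_summandX bal) T XP).
have [I [K [f [g [h [T YI gh _]]]]]] := balanced_right A.
have h0 := ghosts0 _ _ _ _ _ _ T gh; rewrite h0 in T.
by case: (summand_closed_splitting (bp_summandY bal) T YI).
Qed.

End Balanced.

Theorem theorem1p2 (C : additive_category) (Sigma : autoequivalence C)
    (Delta : triangle_class Sigma) (triC : triangulated Delta)
    (X Y : subcategory C) (balXY : balanced_pair Delta X Y) :
  let xi := xi_proj Delta X in
  (forall T, xi T <-> xi_inj Delta Y T) /\
  proper_class Delta xi /\
  exists HE : subbifunctor_closed (in_E_xi Delta xi),
    extriangulated (s_xi HE) /\
    (is_triangulated_category (s_xi HE) <->
       (forall A, X A <-> is_zero A) /\ (forall A, Y A <-> is_zero A)) /\
    (is_exact_category (s_xi HE) <->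
       (forall A, X A) /\ (forall A, Y A)).
Proof.
have SX := bp_stableX balXY.
split; first exact: balanced_xiE.
split; first exact: xi_proj_proper.
exists (ghost_subbifunctor triC SX); split; first exact: s_xi_extriangulated.
split; split.
- exact: balanced_triangulated.
- by move=> [X0 _]; apply: zero_triangulated balXY _ _ => // A /X0.
- exact: balanced_exact.
- move=> [Xall _]; apply: split_is_exact_category => // D A x gx.
  by rewrite -[x]composem1; apply: gx.
Qed.
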